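(* Let $\alpha\in(0,1)$, $\sigma=1-\frac{\alpha}{2}$, $\lambda_1\ge 0$, $\lambda_2\ge 0$, and consider quasi-graded temporal meshes $0=t_0<t_1<\dots<t_N=T$ with degree of grading $r\ge 1$ for which the coefficients of the Alikhanov operator $\delta_t^{\alpha,*}$ satisfy $g_{m-1,j}>g_{m-1,j-1}>0$ for all $1\le j\le m-1\le N-1$. Assume that $\tau=\max_{1\le j\le N}\tau_j$ is sufficiently small. For $\gamma\in\mathbb{R}$ put $$V(j,\gamma):=\tau_1 t_j^{\alpha-1}(\tau_1/t_j)^{\min\{0,\gamma\}},\qquad 1\le j\le N.$$ (i) If $1\le r\le (3-\alpha)/\alpha$ and $\gamma\in\mathbb{R}$, $\gamma\ne 0$, then for real sequences $\{v^j\}_{j=0}^N$, $$\Big[\,v^0=0\ \text{ and }\ \delta_t^{\alpha,*}v^j-\lambda_1 v^j-\lambda_2 v^{j-1}\lesssim(\tau_1/t_j)^{\gamma+1}\ \ \forall\,1\le j\le N\Big]\ \Longrightarrow\ v^j\lesssim V(j,\gamma)\ \ \forall\,1\le j\le N.$$ (ii) The same implication holds if $r\ge 1$ and $\gamma\le\alpha-1$.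
   Context: Temporal mesh: $0=t_0<t_1<\dots<t_N=T$, $\tau_j=t_j-t_{j-1}$, $\tau=\max_j\tau_j$. The mesh (family, indexed by $N$) is quasi-graded with degree of grading $r\ge1$, i.e. $\tau_1\simeq N^{-r}$, $t_n\simeq \tau_1 n^r$, $\tau_n\simeq \tau_1^{1/r}t_n^{1-1/r}$ for $1\le n\le N$. Here $a\lesssim b$ means $a\le Cb$ with a positive constant $C$ independent of $N$, of the time steps and of the index ($C$ may depend on fixed data such as $\alpha,T,r,\gamma,\lambda_1,\lambda_2$ and the constants in the mesh relations); $a\simeq b$ means $a\lesssim b$ and $b\lesssim a$. Thus the implication reads: for each constant $C_0$ in the premise there is a constant $C$ (of the type just described) for the conclusion. ''$\tau$ sufficiently small'' means $\tau\le\tau_*$ for some threshold $\tau_*>0$ depending only on fixed data. Alikhanov operator: for $\sigma\in(0,1]$ let $t_n^*=t_n-(1-\sigma)\tau_n$. For a sequence $\{v^j\}_{j=0}^N$ and $1\le m\le N$, $$\delta_t^{\alpha,*}v^m=\sum_{j=1}^m g_{m-1,j-1}(v^j-v^{j-1}),$$ where $g_{0,0}=\tau_1^{-1}a_{0,0}$ and, for $k\ge1$, $g_{k,0}=\tau_1^{-1}(a_{k,0}-b_{k,0})$, $g_{k,j}=\tau_{j+1}^{-1}(a_{k,j}+b_{k,j-1}-b_{k,j})$ for $1\le j\le k-1$, $g_{k,k}=\tau_{k+1}^{-1}(a_{k,k}+b_{k,k-1})$, with $a_{k,k}=\frac{\sigma^{1-\alpha}}{\Gamma(2-\alpha)}\tau_{k+1}^{1-\alpha}$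 ($k\ge0$) and, for $k\ge 1$, $0\le j\le k-1$, $a_{k,j}=\frac1{\Gamma(1-\alpha)}\int_{t_j}^{t_{j+1}}(t_{k+1}^*-\eta)^{-\alpha}d\eta$, $b_{k,j}=\frac{1}{\Gamma(1-\alpha)}\frac{2}{t_{j+2}-t_j}\int_{t_j}^{t_{j+1}}(t_{k+1}^*-\eta)^{-\alpha}(\eta-t_{j+1/2})d\eta$, $t_{j+1/2}=(t_j+t_{j+1})/2$. *)

(* Defs.v *)
From Stdlib Require Import Reals Arith List.
From Coquelicot Require Import Coquelicot.
Local Open Scope R_scope.

Definition Gamma (z : R) : R :=
  RInt_gen (fun s => Rpower s (z - 1) * exp (- s))
    (at_right 0) (Rbar_locally p_infty).

(* [t : nat -> R] lists the mesh points; only [t 0, ..., t N] matter, and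
   [tau t j] is meaningful for [1 <= j]. *)
Definition tau (t : nat -> R) (j : nat) : R := t j - t (j - 1)%nat.

Definition max_step (t : nat -> R) (N : nat) : R :=
  fold_right Rmax 0 (map (tau t) (seq 1 N)).

Definition mesh (T : R) (N : nat) (t : nat -> R) : Prop :=
  (1 <= N)%nat /\ t 0%nat = 0 /\ t N = T /\
  (forall j, (1 <= j <= N)%nat -> t (j - 1)%nat < t j).

Definition equiv_with (K a b : R) : Prop := a <= K * b /\ b <= K * a.

(* A single [K] serves for the three two-sided relations: it is the maximum of
   the constants occurring in them, and is shared by all meshes of a family. *)
Definition quasi_graded (K r : R) (N : nat) (t : nat -> R) : Prop :=
  equiv_with K (tau t 1) (Rpower (INR N) (- r)) /\
  (forall n, (1 <= n <= N)%nat ->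
     equiv_with K (t n) (tau t 1 * Rpower (INR n) r) /\
     equiv_with K (tau t n)
       (Rpower (tau t 1) (1 / r) * Rpower (t n) (1 - 1 / r))).

Definition tstar (sigma : R) (t : nat -> R) (n : nat) : R :=
  t n - (1 - sigma) * tau t n.

(* Meaningful for [j <= k]; the value for [k <= j] is the one for [j = k]. *)
Definition coef_a (alpha sigma : R) (t : nat -> R) (k j : nat) : R :=
  if (j <? k)%nat then
    1 / Gamma (1 - alpha) *
    RInt (fun eta => Rpower (tstar sigma t (k + 1) - eta) (- alpha))
      (t j) (t (j + 1)%nat)
  else
    Rpower sigma (1 - alpha) / Gamma (2 - alpha) *
    Rpower (tau t (k + 1)) (1 - alpha).

(* Meaningful for [j < k]. *)
Definition coef_b (alpha sigma : R) (t : nat -> R) (k j : nat) : R :=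
  1 / Gamma (1 - alpha) * (2 / (t (j + 2)%nat - t j)) *
  RInt (fun eta => Rpower (tstar sigma t (k + 1) - eta) (- alpha) *
                   (eta - (t j + t (j + 1)%nat) / 2))
    (t j) (t (j + 1)%nat).

(* Meaningful for [j <= k]. *)
Definition coef_g (alpha sigma : R) (t : nat -> R) (k j : nat) : R :=
  let a := coef_a alpha sigma t in
  let b := coef_b alpha sigma t in
  match k, j with
  | O, _ => / tau t 1 * a 0%nat 0%nat
  | S _, O => / tau t 1 * (a k 0%nat - b k 0%nat)
  | S k', S j' =>
      if (j <? k)%nat
      then / tau t (j + 1) * (a k j + b k j' - b k j)
      else / tau t (k + 1) * (a k k + b k k')
  end.

Definition alikhanov (alpha sigma : R) (t v : nat -> R) (m : nat) : R :=
  sum_n_m (fun j => coef_g alpha sigma t (m - 1) (j - 1) *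
                    (v j - v (j - 1)%nat)) 1 m.

Definition monotone_coefs (alpha sigma : R) (N : nat) (t : nat -> R) : Prop :=
  forall m j, (1 <= j)%nat -> (j <= m - 1)%nat -> (m - 1 <= N - 1)%nat ->
    coef_g alpha sigma t (m - 1) j > coef_g alpha sigma t (m - 1) (j - 1) /\
    coef_g alpha sigma t (m - 1) (j - 1) > 0.

Definition barrier (alpha gamma : R) (t : nat -> R) (j : nat) : R :=
  tau t 1 * Rpower (t j) (alpha - 1) * Rpower (tau t 1 / t j) (Rmin 0 gamma).

(* [C] is chosen before [N], the mesh and the sequence, so it depends only on
   [C0] and the parameters of this definition. *)
Definition stability
    (alpha sigma lambda1 lambda2 r T K tau_max gamma : R) : Prop :=
  forall C0 : R, 0 < C0 -> exists C : R, 0 < C /\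
  forall (N : nat) (t : nat -> R),
    mesh T N t -> quasi_graded K r N t -> monotone_coefs alpha sigma N t ->
    max_step t N <= tau_max ->
  forall v : nat -> R,
    v 0%nat = 0 ->
    (forall j, (1 <= j <= N)%nat ->
       alikhanov alpha sigma t v j - lambda1 * v j - lambda2 * v (j - 1)%nat
         <= C0 * Rpower (tau t 1 / t j) (gamma + 1)) ->
    forall j, (1 <= j <= N)%nat -> v j <= C * barrier alpha gamma t j.

(* Main.v *)
Require Import Defs.
From Stdlib Require Import Reals Lra Lia Psatz List.
From Coquelicot Require Import Coquelicot.
Local Open Scope R_scope.

(** By the comparison principle it suffices to find a nonnegative barrier [W] with
    [W 0 = 0], bounded by a multiple of [V(., gamma)], on which the operator is at
    least [(tau_1 / t_j)^(gamma + 1)].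

    For [gamma <= alpha - 1] take [W = tau_1^(gamma+1) t^(alpha-1-gamma) e^(mu t)]:
    it increases, so Abel summation and the lower bound
    [g_{k,j} >= (t*_{k+1} - t_j)^(-alpha) / Gamma(1 - alpha)] give both
    [delta W >= c t^(-alpha) W] and [delta W >= c mu^alpha W]; the latter absorbs the
    reaction terms once [mu] is large.

    Without reaction terms, the building block for [gamma > alpha - 1] is the
    function equal to [0] at [t = 0] and to [(t + a)^(alpha - 1)] for [t > 0], whose
    fractional derivative is exactly
    [a^alpha t^(-alpha) / (Gamma(1 - alpha) (t + a))]. The truncation error of the
    scheme on it is at most a small multiple of this as soon as [a >= M tau_1],
    because [alpha <= (3 - alpha) / r]. Summing over dyadic [a] with weights
    [a^(-gamma)] gives a barrier for [gamma] in [(alpha - 1, alpha)].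

    Reaction terms acting on such a barrier are a right-hand side of the same kind
    with exponent [min(0, gamma) - alpha], so finitely many corrections reduce to the
    case [gamma <= alpha - 1]. *)

(** * The Gamma function *)

(** For [gamma > alpha - 1] the target bound decreases in [t], so Abel summation gives no sign and
    the scheme has to be compared with an exact fractional derivative. The pure power [t^(alpha-1)]
    is annihilated by that derivative; the shift [a] leaves a positive remainder. The smooth part of
    the shifted power contributes negatively. Positivity comes from the jump at [t = 0], which only
    [g_{k,0}] sees, and the lower bound on [g_{k,0}] reproduces the exact jump term without losing a
    constant. One shift does not suffice: its remainder decays like [t^(-alpha)] below [a] and like
    [t^(-alpha-1)] beyond. In the dyadic sum the shift [a] close to [t] alone supplies the required
    [t^(-gamma-1)]. The size of the sum is governed by the smallest shift if [gamma > 0] and by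
    shifts near [t] if [gamma < 0]; at [gamma = 0] all scales below [t] would count equally and
    produce a logarithm. Estimates are stated after multiplication by [Gamma (1 - alpha)]. Of the
    Gamma function this takes positivity and the functional equation, which identifies the diagonal
    coefficient as a kernel integral. *)

Lemma Rpower_pos (x y : R) : 0 < Rpower x y.
Proof. apply exp_pos. Qed.

Lemma Rpower_le_anti (x y p : R) :
  0 < x <= y -> p <= 0 -> Rpower y p <= Rpower x p.
Proof.
intros Hxy Hp.
replace p with (- (- p)) by ring.
rewrite (Rpower_Ropp y), (Rpower_Ropp x).
apply Rinv_le_contravar; [apply Rpower_pos | apply Rle_Rpower_l; lra].
Qed.

Lemma is_derive_Rpower (x y : R) :
  0 < x -> is_derive (fun s => Rpower s y) x (y * Rpower x (y - 1)).
Proof. intros Hx; apply is_derive_Reals, derivable_pt_lim_power, Hx. Qed.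

Lemma continuous_Rpower (x y : R) :
  0 < x -> continuous (fun s => Rpower s y) x.
Proof.
intros Hx; apply (ex_derive_continuous (fun s => Rpower s y)).
eexists; apply is_derive_Rpower, Hx.
Qed.

Definition gamma_density (z s : R) : R := Rpower s (z - 1) * exp (- s).

(** Convergence of the improper integral in epsilon form: estimates then concern compact intervals,
    and filters occur only in [Gamma_of_limit]. *)
Definition gamma_limit (z l : R) : Prop :=
  forall eps, 0 < eps -> exists d M, 0 < d /\ 0 < M /\
    forall x y, 0 < x < d -> M < y -> x <= y ->
      Rabs (RInt (gamma_density z) x y - l) < eps.

Lemma continuous_gamma_density (z s : R) :
  0 < s -> continuous (gamma_density z) s.
Proof.
intros Hs; unfold gamma_density.
apply (continuous_mult (fun s => Rpower s (z - 1)) (fun s => exp (- s))).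
- apply continuous_Rpower, Hs.
- apply (ex_derive_continuous (fun s => exp (- s))); auto_derive; trivial.
Qed.

Lemma ex_RInt_gamma_density (z x y : R) :
  0 < x <= y -> ex_RInt (gamma_density z) x y.
Proof.
intros Hxy; apply (ex_RInt_continuous (gamma_density z)).
rewrite Rmin_left, Rmax_right by lra.
intros s Hs; apply continuous_gamma_density; lra.
Qed.

Lemma gamma_density_pos (z s : R) : 0 < gamma_density z s.
Proof. apply Rmult_lt_0_compat; [apply Rpower_pos | apply exp_pos]. Qed.

Lemma RInt_gamma_density_pos (z x y : R) :
  0 < x < y -> 0 < RInt (gamma_density z) x y.
Proof.
intros Hxy; apply RInt_gt_0; [lra | intros; apply gamma_density_pos |].
intros s Hs; apply continuous_gamma_density; lra.
Qed.

Lemma RInt_gamma_density_mono (z x x' y y' : R) :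
  0 < x' <= x -> x <= y -> y <= y' ->
  RInt (gamma_density z) x y <= RInt (gamma_density z) x' y'.
Proof.
intros Hx Hxy Hy.
assert (nn : forall u v, 0 < u <= v -> 0 <= RInt (gamma_density z) u v).
{ intros u v Huv; apply RInt_ge_0; [lra | apply ex_RInt_gamma_density; lra|].
  intros; apply Rlt_le, gamma_density_pos. }
rewrite <- (RInt_Chasles (gamma_density z) x' x y')
  by (apply ex_RInt_gamma_density; lra).
rewrite <- (RInt_Chasles (gamma_density z) x y y')
  by (apply ex_RInt_gamma_density; lra).
assert (H1 := nn x' x ltac:(lra)). assert (H2 := nn y y' ltac:(lra)).
unfold plus; simpl; lra.
Qed.

Lemma RInt_gamma_density_bound (z x y : R) :
  0 < z < 1 -> 0 < x < 1 -> 1 < y ->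
  RInt (gamma_density z) x y <= / z + 1.
Proof.
intros Hz Hx Hy.
rewrite <- (RInt_Chasles (gamma_density z) x 1 y)
  by (apply ex_RInt_gamma_density; lra).
unfold plus; simpl; apply Rplus_le_compat.
- assert (H : is_RInt (fun s => Rpower s (z - 1)) x 1
               (Rpower 1 z / z - Rpower x z / z)).
  { apply (is_RInt_derive (fun s => Rpower s z / z) (fun s => Rpower s (z - 1)));
    rewrite Rmin_left, Rmax_right by lra; intros s Hs.
    - replace (Rpower s (z - 1)) with (z * Rpower s (z - 1) / z) by (field; lra).
      apply (is_derive_ext (fun s => scal (/ z) (Rpower s z))).
      { intros; unfold scal; simpl; unfold mult; simpl; field; lra. }
      replace (z * Rpower s (z - 1) / z) with (scal (/ z) (z * Rpower s (z - 1)))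
        by (unfold scal; simpl; unfold mult; simpl; field; lra).
      apply is_derive_scal, is_derive_Rpower; lra.
    - apply continuous_Rpower; lra. }
  apply Rle_trans with (Rpower 1 z / z - Rpower x z / z).
  + apply (is_RInt_le (gamma_density z) (fun s => Rpower s (z - 1)) x 1);
      [lra | apply (RInt_correct (gamma_density z)), ex_RInt_gamma_density; lra
      | exact H |].
    intros s Hs; unfold gamma_density.
    assert (exp (- s) < 1) by (rewrite <- exp_0; apply exp_increasing; lra).
    assert (P := Rpower_pos s (z - 1)); nra.
  + unfold Rpower at 1; rewrite ln_1, Rmult_0_r, exp_0.
    assert (P := Rpower_pos x z).
    assert (0 < / z) by (apply Rinv_0_lt_compat; lra).
    unfold Rdiv; nra.
- assert (H : is_RInt (fun s => exp (- s)) 1 y (- exp (- y) - - exp (- 1))).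
  { apply (is_RInt_derive (fun s => - exp (- s)) (fun s => exp (- s)));
    intros s _.
    - auto_derive; trivial; ring.
    - apply (ex_derive_continuous (fun s => exp (- s))); auto_derive; trivial. }
  apply Rle_trans with (- exp (- y) - - exp (- 1)).
  + apply (is_RInt_le (gamma_density z) (fun s => exp (- s)) 1 y);
      [lra | apply (RInt_correct (gamma_density z)), ex_RInt_gamma_density; lra
      | exact H |].
    intros s Hs; unfold gamma_density.
    assert (Rpower s (z - 1) <= 1).
    { apply Rle_trans with (Rpower s 0);
      [apply Rle_Rpower; lra | rewrite Rpower_O; lra]. }
    assert (P := exp_pos (- s)); nra.
  + assert (exp (- 1) < 1) by (rewrite <- exp_0; apply exp_increasing; lra).
    assert (P := exp_pos (- y)); lra.
Qed.

Lemma Gamma_of_limit (z l : R) : gamma_limit z l -> Gamma z = l.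
Proof.
intros Hlim.
refine (@is_RInt_gen_unique R_CompleteNormedModule (at_right 0)
  (Rbar_locally p_infty) _ _ (gamma_density z) l _).
intros P [eps HP].
destruct (Hlim eps (cond_pos eps)) as (d & M & Hd & HM & HdM).
(* Taking [d'] below [M] forces [x < y], which [gamma_limit] demands. *)
set (d' := Rmin d M). assert (Hd' : 0 < d') by (apply Rmin_pos; lra).
assert (H1 := Rmin_l d M). assert (H2 := Rmin_r d M). fold d' in H1, H2.
exists (fun x => 0 < x < d') (fun y => M < y).
- exists (mkposreal d' Hd'); intros y Hy Hy0; split; [exact Hy0|].
  unfold ball in Hy; simpl in Hy.
  unfold AbsRing_ball, abs, minus, plus, opp in Hy; simpl in Hy.
  rewrite Ropp_0, Rplus_0_r, Rabs_pos_eq in Hy; lra.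
- exists M; auto.
- intros x y Hx Hy; exists (RInt (gamma_density z) x y); split; simpl.
  + apply (RInt_correct (gamma_density z)), ex_RInt_gamma_density; lra.
  + apply HP, (HdM x y); lra.
Qed.

(** The density is positive, so its integrals grow with the interval and converge to their
    supremum. *)
Lemma Gamma_pos_limit (z : R) :
  0 < z < 1 -> 0 < Gamma z /\ gamma_limit z (Gamma z).
Proof.
intros Hz.
set (E := fun v =>
  exists x y, 0 < x < 1 /\ 1 < y /\ v = RInt (gamma_density z) x y).
destruct (completeness E) as [l [Hub Hlub]].
{ exists (/ z + 1); intros v (x & y & Hx & Hy & ->).
  apply RInt_gamma_density_bound; lra. }
{ exists (RInt (gamma_density z) (1/2) 2), (1/2), 2; repeat split; lra. }
assert (Hl : 0 < l).
{ apply Rlt_le_trans with (RInt (gamma_density z) (1/2) 2).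
  - apply RInt_gamma_density_pos; lra.
  - apply Hub; exists (1/2), 2; repeat split; lra. }
assert (Hgen : gamma_limit z l).
{ intros eps He.
  destruct (Classical_Prop.classic (exists v, E v /\ l - eps < v))
    as [(v & (x & y & Hx & Hy & ->) & Hv) | Hno].
  - exists x, y; split; [lra|]; split; [lra|]; intros x' y' Hx' Hy' _.
    assert (H1 := RInt_gamma_density_mono z x x' y y'
                    ltac:(lra) ltac:(lra) ltac:(lra)).
    assert (H2 : RInt (gamma_density z) x' y' <= l)
      by (apply Hub; exists x', y'; repeat split; lra).
    rewrite Rabs_left1; lra.
  - exfalso; assert (l <= l - eps); [|lra].
    apply Hlub; intros v Hv; apply Rnot_lt_le; intros Hlt.
    apply Hno; exists v; auto. }
rewrite (Gamma_of_limit z l Hgen); auto.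
Qed.

Lemma RInt_gamma_density_succ (z x y : R) :
  0 < x <= y ->
  RInt (gamma_density (z + 1)) x y =
  z * RInt (gamma_density z) x y
  - (Rpower y z * exp (- y) - Rpower x z * exp (- x)).
Proof.
intros Hxy.
assert (H : is_RInt (fun s => z * gamma_density z s - gamma_density (z + 1) s) x y
              (Rpower y z * exp (- y) - Rpower x z * exp (- x))).
{ apply (is_RInt_derive (fun s => Rpower s z * exp (- s))
          (fun s => z * gamma_density z s - gamma_density (z + 1) s));
  rewrite Rmin_left, Rmax_right by lra; intros s Hs.
  - unfold gamma_density.
    replace (z * (Rpower s (z - 1) * exp (- s)) - Rpower s (z + 1 - 1) * exp (- s))
      with (plus (mult (z * Rpower s (z - 1)) (exp (- s)))
                 (mult (Rpower s z) (- exp (- s))))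
      by (replace (z + 1 - 1) with z by ring; unfold plus, mult; simpl; ring).
    apply (is_derive_mult (fun s => Rpower s z) (fun s => exp (- s))).
    + apply is_derive_Rpower; lra.
    + auto_derive; trivial; ring.
    + intros; apply Rmult_comm.
  - apply (continuous_minus (fun s => z * gamma_density z s)
                            (gamma_density (z + 1))).
    + apply (continuous_scal_r z (gamma_density z)).
      apply continuous_gamma_density; lra.
    + apply continuous_gamma_density; lra. }
assert (H' : is_RInt (fun s => z * gamma_density z s - gamma_density (z + 1) s) x y
              (z * RInt (gamma_density z) x y - RInt (gamma_density (z + 1)) x y)).
{ apply (is_RInt_minus (fun s => z * gamma_density z s) (gamma_density (z + 1))).
  - apply (is_RInt_scal (gamma_density z)).
    apply (RInt_correct (gamma_density z)), ex_RInt_gamma_density; lra.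
  - apply (RInt_correct (gamma_density (z + 1))), ex_RInt_gamma_density; lra. }
apply (is_RInt_unique (V := R_CompleteNormedModule)) in H.
apply (is_RInt_unique (V := R_CompleteNormedModule)) in H'.
rewrite H in H'; lra.
Qed.

Lemma Gamma_succ (z : R) : 0 < z < 1 -> Gamma (z + 1) = z * Gamma z.
Proof.
intros Hz; destruct (Gamma_pos_limit z Hz) as [_ Hlim].
apply Gamma_of_limit; intros eps He.
destruct (Hlim (eps / 3) ltac:(lra)) as (d & M & Hd & HM & HdM).
(* The boundary terms of the integration by parts are to be below [eps / 3]: [d'] gives
   [x^z <= eps / 3], and [12 / eps] comes from [y^z exp(-y) <= y exp(-y) < 4 / y]. *)
set (d' := Rpower (eps / 3) (/ z)).
assert (Hd' : 0 < d') by apply Rpower_pos.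
exists (Rmin d d'), (Rmax M (Rmax 1 (12 / eps))).
assert (P1 := Rmax_l M (Rmax 1 (12 / eps))).
assert (P2 := Rmax_r M (Rmax 1 (12 / eps))).
assert (P3 := Rmax_l 1 (12 / eps)). assert (P4 := Rmax_r 1 (12 / eps)).
assert (P5 := Rmin_l d d'). assert (P6 := Rmin_r d d').
split; [apply Rmin_pos; lra|]; split; [lra|]; intros x y Hx Hy Hxy.
specialize (HdM x y ltac:(lra) ltac:(lra) Hxy).
rewrite RInt_gamma_density_succ by lra.
assert (Hx0 : Rpower x z <= eps / 3).
{ replace (eps / 3) with (Rpower d' z).
  - apply Rle_Rpower_l; lra.
  - unfold d'; rewrite Rpower_mult, Rinv_l, Rpower_1; lra. }
assert (Hex : exp (- x) < 1) by (rewrite <- exp_0; apply exp_increasing; lra).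
assert (Hxx : Rpower x z * exp (- x) < eps / 3).
{ assert (Q := Rpower_pos x z). nra. }
assert (Hyy : Rpower y z * exp (- y) < eps / 3).
{ assert (Hyz : Rpower y z <= y).
  { apply Rle_trans with (Rpower y 1);
      [apply Rle_Rpower; lra | rewrite Rpower_1; lra]. }
  (* [exp y >= (1 + y/2)^2 > y^2/4] *)
  assert (Hey : y * y / 4 < exp y).
  { replace (exp y) with (exp (y / 2) * exp (y / 2))
      by (rewrite <- exp_plus; f_equal; field).
    assert (1 + y / 2 < exp (y / 2)) by (apply exp_ineq1; lra). nra. }
  assert (Q := exp_pos y).
  rewrite exp_Ropp.
  apply (Rmult_lt_reg_r (exp y)); [lra|].
  rewrite Rmult_assoc, Rinv_l, Rmult_1_r by lra.
  assert (12 < y * eps).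
  { apply (Rmult_lt_reg_r (/ eps)); [apply Rinv_0_lt_compat; lra|].
    rewrite Rmult_assoc, Rinv_r by lra. unfold Rdiv in P4; lra. }
  apply Rle_lt_trans with y; [exact Hyz|].
  nra. }
assert (Q1 : 0 < Rpower x z * exp (- x))
  by (apply Rmult_lt_0_compat; [apply Rpower_pos | apply exp_pos]).
assert (Q2 : 0 < Rpower y z * exp (- y))
  by (apply Rmult_lt_0_compat; [apply Rpower_pos | apply exp_pos]).
apply Rabs_def2 in HdM. apply Rabs_def1; nra.
Qed.

(** * Moments of the kernel on one interval *)

Lemma continuous_kernel (al x s : R) :
  s < x -> continuous (fun s => Rpower (x - s) (- al)) s.
Proof.
intros Hs.
apply (continuous_comp (fun s => x - s) (fun y => Rpower y (- al))).
- apply (ex_derive_continuous (fun s => x - s)); auto_derive; trivial.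
- apply continuous_Rpower; lra.
Qed.

Lemma is_RInt_kernel (al x l r : R) :
  l < r < x ->
  is_RInt (fun s => Rpower (x - s) (- al)) l r
    (RInt (fun s => Rpower (x - s) (- al)) l r).
Proof.
intros H; apply (RInt_correct (fun s => Rpower (x - s) (- al))).
apply (ex_RInt_continuous (fun s => Rpower (x - s) (- al))).
rewrite Rmin_left, Rmax_right by lra; intros s Hs; apply continuous_kernel; lra.
Qed.

Definition kernel_moment (al x l r : R) : R :=
  RInt (fun s => Rpower (x - s) (- al) * (s - (l + r) / 2)) l r.

Lemma is_RInt_kernel_moment (al x l r : R) :
  l < r < x ->
  is_RInt (fun s => Rpower (x - s) (- al) * (s - (l + r) / 2)) l r
    (kernel_moment al x l r).
Proof.
intros H.
apply (RInt_correct (fun s => Rpower (x - s) (- al) * (s - (l + r) / 2))).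
apply (ex_RInt_continuous (fun s => Rpower (x - s) (- al) * (s - (l + r) / 2))).
rewrite Rmin_left, Rmax_right by lra; intros s Hs.
apply (continuous_mult (fun s => Rpower (x - s) (- al))
                       (fun s => s - (l + r) / 2)).
- apply continuous_kernel; lra.
- apply (ex_derive_continuous (fun s => s - (l + r) / 2)); auto_derive; trivial.
Qed.

Lemma is_RInt_affine (c d l r : R) :
  is_RInt (fun s => c + d * (s - (l + r) / 2)) l r (c * (r - l)).
Proof.
replace (c * (r - l)) with
  ((c * r + d * (r - (l + r) / 2) ^ 2 / 2) - (c * l + d * (l - (l + r) / 2) ^ 2 / 2))
  by field.
apply (is_RInt_derive (fun s => c * s + d * (s - (l + r) / 2) ^ 2 / 2)
                      (fun s => c + d * (s - (l + r) / 2))); intros s _.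
- auto_derive; trivial; field.
- apply (ex_derive_continuous (fun s => c + d * (s - (l + r) / 2)));
    auto_derive; trivial.
Qed.

Lemma kernel_mono (al x s s' : R) :
  0 <= al -> s <= s' < x -> Rpower (x - s) (- al) <= Rpower (x - s') (- al).
Proof. intros Ha Hs; apply Rpower_le_anti; lra. Qed.

(** The kernel increases, so it exceeds its midpoint value exactly where the linear factor is
    positive; against the constant midpoint value the moment is 0. *)
Lemma kernel_moment_nonneg (al x l r : R) :
  0 <= al -> l < r < x -> 0 <= kernel_moment al x l r.
Proof.
intros Ha H.
assert (I := is_RInt_affine 0 (Rpower (x - (l + r) / 2) (- al)) l r).
rewrite Rmult_0_l in I.
refine (is_RInt_le _ _ l r _ _ _ I (is_RInt_kernel_moment al x l r H) _); [lra|].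
intros s Hs; rewrite Rplus_0_l.
destruct (Rle_dec s ((l + r) / 2)) as [Hm | Hm].
- assert (K := kernel_mono al x s ((l + r) / 2) Ha ltac:(lra)). nra.
- assert (K := kernel_mono al x ((l + r) / 2) s Ha ltac:(lra)). nra.
Qed.

(** By [c * (r - l) <= 2] the weight [1 - c (s - (l + r) / 2)] is nonnegative, and its integral is
    [r - l]; hence the kernel may be replaced by its minimum, the value at [l]. *)
Lemma kernel_weight_lower (al x l r c : R) :
  0 <= al -> l < r < x -> 0 <= c -> c * (r - l) <= 2 ->
  Rpower (x - l) (- al) * (r - l) <=
  RInt (fun s => Rpower (x - s) (- al)) l r - c * kernel_moment al x l r.
Proof.
intros Ha H Hc Hcr.
assert (I1 := is_RInt_affine (Rpower (x - l) (- al))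
                (- c * Rpower (x - l) (- al)) l r).
assert (I2 : is_RInt (fun s => Rpower (x - s) (- al)
                               - c * (Rpower (x - s) (- al) * (s - (l + r) / 2))) l r
   (RInt (fun s => Rpower (x - s) (- al)) l r - c * kernel_moment al x l r)).
{ apply (is_RInt_minus (fun s => Rpower (x - s) (- al))
           (fun s => c * (Rpower (x - s) (- al) * (s - (l + r) / 2)))).
  - apply is_RInt_kernel, H.
  - apply (is_RInt_scal (fun s => Rpower (x - s) (- al) * (s - (l + r) / 2))).
    apply is_RInt_kernel_moment, H. }
refine (is_RInt_le _ _ l r _ _ _ I1 I2 _); [lra|].
intros s Hs.
assert (K := kernel_mono al x l s Ha ltac:(lra)).
assert (W : 0 <= 1 - c * (s - (l + r) / 2)) by nra.
nra.
Qed.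

(* With [e = d + D (s - (l + r) / 2) - g], which has mean zero on [l, r], one
   has [int f e = int (f - f l) e], where [0 <= f - f l <= f r - f l]. *)
Lemma kernel_interpolation_lower (al x l r d D E : R) (g F U : R -> R) :
  0 <= al -> l < r < x ->
  (forall s, l <= s <= r -> is_derive F s (Rpower (x - s) (- al) * g s)) ->
  (forall s, l <= s <= r -> is_derive U s (g s)) ->
  (forall s, l <= s <= r -> continuous g s) ->
  U r - U l = d * (r - l) ->
  (forall s, l <= s <= r -> Rabs (d + D * (s - (l + r) / 2) - g s) <= E) ->
  F r - F l - (Rpower (x - r) (- al) - Rpower (x - l) (- al)) * (r - l) * E <=
  d * RInt (fun s => Rpower (x - s) (- al)) l r + D * kernel_moment al x l r.
Proof.
intros Ha H HF HU Hg Hd HE.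
set (f := fun s => Rpower (x - s) (- al)).
assert (IF : is_RInt (fun s => f s * g s) l r (F r - F l)).
{ apply (is_RInt_derive F (fun s => f s * g s));
    rewrite Rmin_left, Rmax_right by lra; intros s Hs.
  - apply HF, Hs.
  - apply (continuous_mult f g); [apply continuous_kernel; lra | apply Hg, Hs]. }
assert (IU : is_RInt g l r (U r - U l)).
{ apply (is_RInt_derive U g); rewrite Rmin_left, Rmax_right by lra; intros s Hs;
    [apply HU | apply Hg]; exact Hs. }
assert (I1 : is_RInt (fun s => (d * f s + D * (f s * (s - (l + r) / 2))) - f s * g s)
               l r ((d * RInt f l r + D * kernel_moment al x l r) - (F r - F l))).
{ apply (is_RInt_minus (fun s => d * f s + D * (f s * (s - (l + r) / 2)))
                       (fun s => f s * g s)); [|exact IF].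
  apply (is_RInt_plus (fun s => d * f s)
                      (fun s => D * (f s * (s - (l + r) / 2)))).
  - apply (is_RInt_scal f), is_RInt_kernel, H.
  - apply (is_RInt_scal (fun s => f s * (s - (l + r) / 2))).
    apply is_RInt_kernel_moment, H. }
assert (I2 : is_RInt (fun s => f l * ((d + D * (s - (l + r) / 2)) - g s)
                               - (f r - f l) * E) l r
               (f l * (d * (r - l) - (U r - U l)) - (r - l) * ((f r - f l) * E))).
{ apply (is_RInt_minus (fun s => f l * ((d + D * (s - (l + r) / 2)) - g s))
                       (fun _ => (f r - f l) * E)).
  - apply (is_RInt_scal (fun s => (d + D * (s - (l + r) / 2)) - g s)).
    apply (is_RInt_minus (fun s => d + D * (s - (l + r) / 2)) g); [|exact IU].
    apply is_RInt_affine.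
  - apply (is_RInt_const (V := R_NormedModule)). }
assert (Hle := is_RInt_le _ _ l r _ _ ltac:(lra) I2 I1).
lapply Hle; [unfold f; nra|].
intros s Hs.
assert (K1 := kernel_mono al x l s Ha ltac:(lra)).
assert (K2 := kernel_mono al x s r Ha ltac:(lra)).
fold (f l) (f s) (f r) in K1, K2.
specialize (HE s ltac:(lra)). apply Rabs_le_between in HE.
set (e := d + D * (s - (l + r) / 2) - g s) in *.
assert (E0 : 0 <= E) by lra.
replace ((d * f s + D * (f s * (s - (l + r) / 2))) - f s * g s)
  with (f s * e) by (unfold e; ring).
nra.
Qed.

(** * Coefficients of the Alikhanov operator *)

Lemma mesh_step_pos (T : R) (N : nat) (t : nat -> R) (j : nat) :
  mesh T N t -> (j < N)%nat -> t j < t (S j).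
Proof.
intros (_ & _ & _ & H) Hj; specialize (H (S j) ltac:(lia)).
simpl in H; rewrite Nat.sub_0_r in H; exact H.
Qed.

Lemma tau_S (t : nat -> R) (j : nat) : tau t (S j) = t (S j) - t j.
Proof. unfold tau; simpl; rewrite Nat.sub_0_r; reflexivity. Qed.

Lemma mesh_lt (T : R) (N : nat) (t : nat -> R) (i j : nat) :
  mesh T N t -> (i < j <= N)%nat -> t i < t j.
Proof.
intros Hm [Hij HjN]; induction Hij as [|j Hij IH].
- apply (mesh_step_pos T N); [exact Hm | lia].
- apply Rlt_trans with (t j); [apply IH; lia|].
  apply (mesh_step_pos T N); [exact Hm | lia].
Qed.

Lemma mesh_le (T : R) (N : nat) (t : nat -> R) (i j : nat) :
  mesh T N t -> (i <= j <= N)%nat -> t i <= t j.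
Proof.
intros Hm Hij; destruct (Nat.eq_dec i j) as [-> | Hne]; [lra|].
apply Rlt_le, (mesh_lt T N); [exact Hm | lia].
Qed.

Lemma tstar_S (sigma : R) (t : nat -> R) (j : nat) :
  tstar sigma t (S j) = t j + sigma * (t (S j) - t j).
Proof. unfold tstar; rewrite tau_S; ring. Qed.

Section Coefficients.

Context (alpha sigma T : R) (N : nat) (t : nat -> R).
Context (Halpha : 0 < alpha < 1) (Hsigma : sigma = 1 - alpha / 2).
Context (Hmesh : mesh T N t).

Let G := Gamma (1 - alpha).
Let ts := tstar sigma t.

Lemma Gamma_1_alpha_pos : 0 < G.
Proof. apply Gamma_pos_limit; lra. Qed.

Lemma tstar_between (j : nat) : (j < N)%nat -> t j < ts (S j) < t (S j).
Proof.
intros Hj; unfold ts; rewrite tstar_S.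
assert (H := mesh_step_pos T N t j Hmesh Hj); nra.
Qed.

Lemma coef_a_lt (k j : nat) :
  (j < k)%nat ->
  G * coef_a alpha sigma t k j =
  RInt (fun s => Rpower (ts (S k) - s) (- alpha)) (t j) (t (S j)).
Proof.
intros Hjk; unfold coef_a; rewrite (proj2 (Nat.ltb_lt j k) Hjk).
rewrite !Nat.add_1_r; assert (HG := Gamma_1_alpha_pos).
fold G; unfold ts; field; lra.
Qed.

(** With [Gamma (2 - alpha) = (1 - alpha) * Gamma (1 - alpha)] the diagonal coefficient becomes the
    kernel integral over [[t k, ts (S k)]], in line with the other coefficients. *)
Lemma coef_a_diag (k : nat) :
  (k < N)%nat ->
  G * coef_a alpha sigma t k k =
  Rpower (ts (S k) - t k) (1 - alpha) / (1 - alpha).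
Proof.
intros Hk; unfold coef_a; rewrite Nat.ltb_irrefl.
replace (2 - alpha) with ((1 - alpha) + 1) by ring.
rewrite Gamma_succ, Nat.add_1_r, tau_S by lra; fold G.
assert (HG := Gamma_1_alpha_pos).
assert (H := mesh_step_pos T N t k Hmesh Hk).
unfold ts; rewrite tstar_S.
replace (t k + sigma * (t (S k) - t k) - t k) with (sigma * (t (S k) - t k)) by ring.
rewrite <- Rpower_mult_distr by lra.
field; lra.
Qed.

Lemma coef_b_lt (k j : nat) :
  G * coef_b alpha sigma t k j =
  2 / (t (S (S j)) - t j) * kernel_moment alpha (ts (S k)) (t j) (t (S j)).
Proof.
unfold coef_b, kernel_moment.
replace (j + 2)%nat with (S (S j)) by lia; rewrite !Nat.add_1_r.
assert (HG := Gamma_1_alpha_pos); fold G; fold ts.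
replace (G * (1 / G * (2 / (t (S (S j)) - t j)) *
   RInt (fun eta : R => Rpower (ts (S k) - eta) (- alpha) * (eta - (t j + t (S j)) / 2))
     (t j) (t (S j)))) with
  (G * / G * (2 / (t (S (S j)) - t j)) *
   RInt (fun eta : R => Rpower (ts (S k) - eta) (- alpha) * (eta - (t j + t (S j)) / 2))
     (t j) (t (S j))) by (unfold Rdiv; ring).
rewrite Rinv_r, Rmult_1_l by lra; reflexivity.
Qed.

Lemma coef_b_nonneg (k j : nat) :
  (j < k < N)%nat -> 0 <= G * coef_b alpha sigma t k j.
Proof.
intros Hjk; rewrite coef_b_lt.
assert (H1 := mesh_lt T N t j (S j) Hmesh ltac:(lia)).
assert (H2 := mesh_lt T N t (S j) (S (S j)) Hmesh ltac:(lia)).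
assert (H3 := mesh_le T N t (S j) k Hmesh ltac:(lia)).
assert (H4 := tstar_between k ltac:(lia)).
apply Rmult_le_pos.
- apply Rlt_le, Rdiv_lt_0_compat; lra.
- apply kernel_moment_nonneg; lra.
Qed.

Lemma coef_ab_lower (k j : nat) :
  (j < k < N)%nat ->
  Rpower (ts (S k) - t j) (- alpha) * (t (S j) - t j) <=
  G * (coef_a alpha sigma t k j - coef_b alpha sigma t k j).
Proof.
intros Hjk; rewrite (Rmult_minus_distr_l G), coef_a_lt, coef_b_lt by lia.
assert (H1 := mesh_lt T N t j (S j) Hmesh ltac:(lia)).
assert (H2 := mesh_lt T N t (S j) (S (S j)) Hmesh ltac:(lia)).
assert (H3 := mesh_le T N t (S j) k Hmesh ltac:(lia)).
assert (H4 := tstar_between k ltac:(lia)).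
apply kernel_weight_lower; try lra.
- apply Rlt_le, Rdiv_lt_0_compat; lra.
- apply (Rmult_le_reg_r (t (S (S j)) - t j)); [lra|].
  replace (2 / (t (S (S j)) - t j) * (t (S j) - t j) * (t (S (S j)) - t j))
    with (2 * (t (S j) - t j)) by (field; lra).
  lra.
Qed.

(** The kernel integral stops at [ts (S k)], but the factor [sigma / (1 - alpha)] it produces is at
    least 1 because [sigma = 1 - alpha / 2]. *)
Lemma coef_a_diag_lower (k : nat) :
  (k < N)%nat ->
  Rpower (ts (S k) - t k) (- alpha) * (t (S k) - t k) <=
  G * coef_a alpha sigma t k k.
Proof.
intros Hk; rewrite coef_a_diag by exact Hk.
assert (H := tstar_between k Hk).
replace (1 - alpha) with (- alpha + 1) at 1 by ring.
rewrite Rpower_plus, Rpower_1 by lra.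
unfold Rdiv; rewrite Rmult_assoc.
apply Rmult_le_compat_l; [apply Rlt_le, Rpower_pos|].
unfold ts; rewrite tstar_S.
assert (H0 := mesh_step_pos T N t k Hmesh Hk).
apply (Rmult_le_reg_r (1 - alpha)); [lra|].
rewrite Rmult_assoc, Rinv_l by lra. nra.
Qed.

(** The subtracted [b_{k,j}] is absorbed by [a_{k,j}] on the same interval, and [b_{k,j-1}],
    inherited from the previous one, is nonnegative. No constant is lost, which is essential for
    [j = 0], where a jump at the origin has to be recovered exactly. *)
Lemma coef_g_lower (k j : nat) :
  (j <= k < N)%nat ->
  Rpower (ts (S k) - t j) (- alpha) <= G * coef_g alpha sigma t k j.
Proof.
intros Hjk; assert (HG := Gamma_1_alpha_pos).
assert (Hj := mesh_step_pos T N t j Hmesh ltac:(lia)).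
enough (H : Rpower (ts (S k) - t j) (- alpha) * (t (S j) - t j) <=
            G * coef_g alpha sigma t k j * (t (S j) - t j))
  by (apply Rmult_le_reg_r in H; lra).
unfold coef_g; destruct k as [|k].
- replace j with 0%nat in * by lia.
  eapply Rle_trans; [apply (coef_a_diag_lower 0); lia|].
  rewrite tau_S; right; field; lra.
- destruct j as [|j].
  + eapply Rle_trans; [apply (coef_ab_lower (S k) 0); lia|].
    rewrite tau_S; right; field; lra.
  + rewrite Nat.add_1_r, tau_S.
    assert (B := coef_b_nonneg (S k) j ltac:(lia)).
    destruct (Nat.ltb_spec (S j) (S k)) as [Hlt | Hge].
    * assert (A := coef_ab_lower (S k) (S j) ltac:(lia)).
      replace (G * (/ (t (S (S j)) - t (S j)) *
         (coef_a alpha sigma t (S k) (S j) + coef_b alpha sigma t (S k) j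
          - coef_b alpha sigma t (S k) (S j))) * (t (S (S j)) - t (S j)))
       with (G * (coef_a alpha sigma t (S k) (S j) - coef_b alpha sigma t (S k) (S j))
             + G * coef_b alpha sigma t (S k) j) by (field; lra).
      lra.
    * replace j with k in * by lia.
      assert (A := coef_a_diag_lower (S k) ltac:(lia)).
      rewrite Nat.add_1_r, tau_S.
      replace (G * (/ (t (S (S k)) - t (S k)) *
         (coef_a alpha sigma t (S k) (S k) + coef_b alpha sigma t (S k) k))
         * (t (S (S k)) - t (S k)))
       with (G * coef_a alpha sigma t (S k) (S k)
             + G * coef_b alpha sigma t (S k) k) by (field; lra).
      lra.
Qed.

Definition slope (v : nat -> R) (j : nat) : R :=
  (v (S j) - v j) / (t (S j) - t j).

(** Regrouped by intervals, the scheme integrates the kernel against the derivative of an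
    interpolant: quadratic through three consecutive nodes on the intervals before [t k], linear on
    the last one. *)
Lemma alikhanov_slopes (v : nat -> R) (k : nat) :
  (k < N)%nat ->
  alikhanov alpha sigma t v (S k) =
  sum_n_m (fun i => coef_a alpha sigma t k (i - 1) * slope v (i - 1)
     + coef_b alpha sigma t k (i - 1) * (slope v i - slope v (i - 1))) 1 k
  + coef_a alpha sigma t k k * slope v k.
Proof.
intros Hk.
set (A := coef_a alpha sigma t k). set (B := coef_b alpha sigma t k).
assert (Hstep : forall j, (j <= k)%nat -> 0 < t (S j) - t j).
{ intros j Hj; assert (H := mesh_step_pos T N t j Hmesh ltac:(lia)); lra. }
(* The product of [b_{k,p-1}] with slope [p] belongs to the coefficient of the next increment, so a
   partial sum lacks it until that increment is added. *)
assert (Hpart : forall p, (p <= k)%nat ->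
  sum_n_m (fun j => coef_g alpha sigma t k (j - 1) * (v j - v (j - 1)%nat)) 1 p =
  sum_n_m (fun i => A (i - 1)%nat * slope v (i - 1)
           + B (i - 1)%nat * (slope v i - slope v (i - 1))) 1 p
  - match p with O => 0 | S q => B q * slope v p end).
{ induction p as [|p IH]; intros Hp.
  - rewrite !sum_n_m_zero by lia. unfold zero; simpl; ring.
  - rewrite !sum_n_Sm by lia; rewrite IH by lia.
    unfold plus; simpl; rewrite Nat.sub_0_r.
    replace (v (S p) - v p) with (slope v p * (t (S p) - t p))
      by (unfold slope; field; specialize (Hstep p ltac:(lia)); lra).
    assert (Hsp := Hstep p ltac:(lia)).
    unfold coef_g; fold A B; destruct k as [|k']; [lia|].
    destruct p as [|p].
    + rewrite tau_S; field; lra.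
    + rewrite (proj2 (Nat.ltb_lt (S p) (S k'))) by lia.
      rewrite Nat.add_1_r, tau_S; field; lra. }
unfold alikhanov. replace (S k - 1)%nat with k by lia.
rewrite sum_n_Sm by lia; rewrite Hpart by lia.
unfold plus; simpl; rewrite Nat.sub_0_r.
replace (v (S k) - v k) with (slope v k * (t (S k) - t k))
  by (unfold slope; field; specialize (Hstep k ltac:(lia)); lra).
assert (Hsp := Hstep k ltac:(lia)).
unfold coef_g; fold A B; destruct k as [|k].
- rewrite tau_S; fold A; field; lra.
- rewrite Nat.ltb_irrefl, Nat.add_1_r, tau_S; field; lra.
Qed.

End Coefficients.

(** * Comparison principle *)

Lemma alikhanov_ext (alpha sigma : R) (t v w : nat -> R) (m : nat) :
  (forall j, (j <= m)%nat -> v j = w j) ->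
  alikhanov alpha sigma t v m = alikhanov alpha sigma t w m.
Proof.
intros H; apply sum_n_m_ext_loc; intros j Hj.
rewrite !H by lia; reflexivity.
Qed.

Lemma alikhanov_lin (alpha sigma : R) (t v w : nat -> R) (a b : R) (m : nat) :
  alikhanov alpha sigma t (fun j => a * v j + b * w j) m =
  a * alikhanov alpha sigma t v m + b * alikhanov alpha sigma t w m.
Proof.
unfold alikhanov.
rewrite <- (sum_n_m_mult_l (K := R_Ring) a), <- (sum_n_m_mult_l (K := R_Ring) b).
rewrite <- (sum_n_m_plus (G := R_AbelianMonoid)).
apply sum_n_m_ext_loc; intros j _; unfold plus, mult; simpl; ring.
Qed.

Section Comparison.

Context (alpha sigma T : R) (N : nat) (t : nat -> R).
Context (Halpha : 0 < alpha < 1) (Hsigma : sigma = 1 - alpha / 2).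
Context (Hmesh : mesh T N t) (Hmono : monotone_coefs alpha sigma N t).

Let g := coef_g alpha sigma t.
Let partial (v : nat -> R) (k p : nat) :=
  sum_n_m (fun j => g k (j - 1) * (v j - v (j - 1)%nat)) 1 p.

Lemma coef_g_pos (k j : nat) : (j <= k < N)%nat -> 0 < g k j.
Proof.
intros H.
assert (HG := Gamma_1_alpha_pos alpha Halpha).
assert (L := coef_g_lower alpha sigma T N t Halpha Hsigma Hmesh k j H).
assert (P := Rpower_pos (tstar sigma t (S k) - t j) (- alpha)).
fold g in L; nra.
Qed.

Lemma coef_g_le (k i j : nat) : (i <= j <= k)%nat -> (k < N)%nat -> g k i <= g k j.
Proof.
intros [Hij Hjk] HkN; induction Hij as [|j Hij IH]; [lra|].
apply Rle_trans with (g k j); [apply IH; lia|].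
destruct (Hmono (S k) (S j)) as [H _]; try lia.
replace (S k - 1)%nat with k in H by lia.
replace (S j - 1)%nat with j in H by lia. fold g in H; lra.
Qed.

Lemma partial_S (v : nat -> R) (k p : nat) :
  partial v k (S p) = partial v k p + g k p * (v (S p) - v p).
Proof.
unfold partial; rewrite sum_n_Sm by lia; unfold plus; simpl.
rewrite Nat.sub_0_r; reflexivity.
Qed.

Lemma alikhanov_partial (v : nat -> R) (k : nat) :
  alikhanov alpha sigma t v (S k) = partial v k (S k).
Proof. unfold alikhanov, partial, g; rewrite Nat.sub_succ, Nat.sub_0_r; reflexivity. Qed.

(** Abel summation: each earlier value enters with the factor [g_{k,p} - g_{k,p+1} <= 0], and the
    initial one with [- g_{k,0} < 0], so nonpositive values only increase the sum. *)
Lemma alikhanov_ge_diag (v : nat -> R) (k : nat) :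
  (k < N)%nat -> (forall j, (j <= k)%nat -> v j <= 0) ->
  g k k * v (S k) <= alikhanov alpha sigma t v (S k).
Proof.
intros HkN Hv; rewrite alikhanov_partial.
assert (H : forall p, (p <= k)%nat -> g k p * v (S p) <= partial v k (S p)).
{ induction p as [|p IH]; intros Hp; rewrite partial_S.
  - unfold partial; rewrite sum_n_m_zero by lia; unfold zero; simpl.
    assert (P := coef_g_pos k 0 ltac:(lia)). specialize (Hv 0%nat ltac:(lia)). nra.
  - assert (L := coef_g_le k p (S p) ltac:(lia) HkN).
    specialize (IH ltac:(lia)). specialize (Hv (S p) ltac:(lia)). nra. }
apply H; lia.
Qed.

(** Induction on the time level: once the earlier values are nonpositive, [(g_{k,k} - lambda1)
    v_{k+1} <= lambda2 v_k <= 0]. *)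
Lemma comparison (lambda1 lambda2 : R) (v : nat -> R) :
  0 <= lambda2 -> (forall k, (k < N)%nat -> lambda1 < g k k) ->
  v 0%nat <= 0 ->
  (forall k, (k < N)%nat ->
     alikhanov alpha sigma t v (S k) - lambda1 * v (S k) - lambda2 * v k <= 0) ->
  forall j, (j <= N)%nat -> v j <= 0.
Proof.
intros Hl2 Hl1 H0 Hv.
assert (H : forall n, (n <= N)%nat -> forall j, (j <= n)%nat -> v j <= 0).
{ induction n as [|n IH]; intros Hn j Hj.
  - replace j with 0%nat by lia; exact H0.
  - destruct (Nat.eq_dec j (S n)) as [-> | Hne]; [|apply IH; lia].
    assert (A := alikhanov_ge_diag v n ltac:(lia) (IH ltac:(lia))).
    assert (Vn := IH ltac:(lia) n ltac:(lia)).
    specialize (Hl1 n ltac:(lia)); specialize (Hv n ltac:(lia)). nra. }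
intros j Hj; apply (H N); lia.
Qed.

(** The increments before [q] are dropped, being nonnegative; the later ones have weights at least
    [g_{k,q}] and telescope. *)
Lemma alikhanov_increasing_lower (v : nat -> R) (k q : nat) :
  (q <= k < N)%nat -> (forall j, (j <= k)%nat -> v j <= v (S j)) ->
  Rpower (tstar sigma t (S k) - t q) (- alpha) * (v (S k) - v q) <=
  Gamma (1 - alpha) * alikhanov alpha sigma t v (S k).
Proof.
intros Hq Hv; rewrite alikhanov_partial.
assert (H1 : forall p, (p <= S k)%nat -> 0 <= partial v k p).
{ induction p as [|p IH]; intros Hp.
  - unfold partial; rewrite sum_n_m_zero by lia; unfold zero; simpl; lra.
  - rewrite partial_S. specialize (IH ltac:(lia)). specialize (Hv p ltac:(lia)).
    assert (P := coef_g_pos k p ltac:(lia)). nra. }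
assert (H2 : forall p, (p <= S k - q)%nat ->
          g k q * (v (q + p)%nat - v q) <= partial v k (q + p)).
{ induction p as [|p IH]; intros Hp.
  - rewrite Nat.add_0_r, Rminus_diag_eq, Rmult_0_r by reflexivity.
    apply H1; lia.
  - rewrite Nat.add_succ_r, partial_S.
    specialize (IH ltac:(lia)). specialize (Hv (q + p)%nat ltac:(lia)).
    assert (P := coef_g_le k q (q + p) ltac:(lia) ltac:(lia)). nra. }
specialize (H2 (S k - q)%nat ltac:(lia)).
replace (q + (S k - q))%nat with (S k) in H2 by lia.
assert (HG := Gamma_1_alpha_pos alpha Halpha).
assert (L := coef_g_lower alpha sigma T N t Halpha Hsigma Hmesh k q ltac:(lia)).
fold g in L.
assert (Vq : v q <= v (S k)).
{ assert (Hc : forall p, (q + p <= S k)%nat -> v q <= v (q + p)%nat).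
  { induction p as [|p IH]; intros Hp; [rewrite Nat.add_0_r; lra|].
    rewrite Nat.add_succ_r.
    specialize (IH ltac:(lia)). specialize (Hv (q + p)%nat ltac:(lia)). lra. }
  specialize (Hc (S k - q)%nat ltac:(lia)).
  replace (q + (S k - q))%nat with (S k) in Hc by lia. exact Hc. }
apply Rle_trans with (Gamma (1 - alpha) * g k q * (v (S k) - v q)); [nra|].
rewrite Rmult_assoc; apply Rmult_le_compat_l; lra.
Qed.

End Comparison.

(** * Quadratic interpolation *)

Lemma bounded_derive_lipschitz (f df : R -> R) (a b L x y : R) :
  (forall s, a <= s <= b -> is_derive f s (df s)) ->
  (forall s, a <= s <= b -> Rabs (df s) <= L) ->
  a <= x <= b -> a <= y <= b -> Rabs (f y - f x) <= L * Rabs (y - x).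
Proof.
intros Hf HL Hx Hy.
assert (Hm : a <= Rmin x y) by (apply Rmin_glb; lra).
assert (HM : Rmax x y <= b) by (apply Rmax_lub; lra).
destruct (MVT_gen f x y df) as (c & Hc & ->).
- intros s Hs; apply Hf; lra.
- intros s Hs; apply continuity_pt_filterlim.
  apply (ex_derive_continuous f); eexists; apply Hf; lra.
- rewrite Rabs_mult; apply Rmult_le_compat_r; [apply Rabs_pos | apply HL; lra].
Qed.

Lemma rolle_derive (f df : R -> R) (a b : R) :
  a < b -> (forall s, a <= s <= b -> is_derive f s (df s)) -> f a = f b ->
  exists c, a < c < b /\ df c = 0.
Proof.
intros Hab Hf Hfab.
destruct (MVT_cor2 f df a b Hab) as (c & Hc & Hc').
{ intros s Hs; apply is_derive_Reals, Hf, Hs. }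
exists c; split; [exact Hc'|].
assert (E : df c * (b - a) = 0) by lra.
apply Rmult_integral in E; destruct E; lra.
Qed.

(* The interpolation error vanishes at three points, so its first two
   derivatives vanish somewhere in [l, z]. *)
Lemma quadratic_interpolation_derive (u du d2u d3u : R -> R) (l r z L s : R) :
  l < r < z ->
  (forall x, l <= x <= z -> is_derive u x (du x)) ->
  (forall x, l <= x <= z -> is_derive du x (d2u x)) ->
  (forall x, l <= x <= z -> is_derive d2u x (d3u x)) ->
  (forall x, l <= x <= z -> Rabs (d3u x) <= L) ->
  l <= s <= z ->
  let d := (u r - u l) / (r - l) in
  let d' := (u z - u r) / (z - r) in
  Rabs (d + 2 / (z - l) * (d' - d) * (s - (l + r) / 2) - du s) <= L * (z - l) ^ 2.
Proof.
intros H Hu Hdu Hd2u HL Hs d d'.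
set (D := 2 / (z - l) * (d' - d)).
set (e := fun x => u l + d * (x - l) + D / 2 * (x - l) * (x - r) - u x).
set (de := fun x => d + D * (x - (l + r) / 2) - du x).
set (d2e := fun x => D - d2u x).
assert (He : forall x, l <= x <= z -> is_derive e x (de x)).
{ intros x Hx; unfold e, de.
  apply (is_derive_minus (fun x => u l + d * (x - l) + D / 2 * (x - l) * (x - r)) u);
    [|apply Hu, Hx].
  auto_derive; trivial; field. }
assert (Hde : forall x, l <= x <= z -> is_derive de x (d2e x)).
{ intros x Hx; unfold de, d2e.
  apply (is_derive_minus (fun x => d + D * (x - (l + r) / 2)) du); [|apply Hdu, Hx].
  auto_derive; trivial; field. }
assert (Hd2e : forall x, l <= x <= z -> is_derive d2e x (0 - d3u x)).
{ intros x Hx; unfold d2e.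
  apply (is_derive_minus (fun _ => D) d2u); [|apply Hd2u, Hx].
  auto_derive; trivial. }
assert (El : e l = 0) by (unfold e; ring).
assert (Er : e r = 0) by (unfold e, d; field; lra).
assert (Ez : e z = 0).
{ unfold e, D, d', d; field; lra. }
destruct (rolle_derive e de l r) as (x1 & Hx1 & E1);
  [lra | intros; apply He; lra | lra |].
destruct (rolle_derive e de r z) as (x2 & Hx2 & E2);
  [lra | intros; apply He; lra | lra |].
destruct (rolle_derive de d2e x1 x2) as (y & Hy & E3);
  [lra | intros; apply Hde; lra | lra |].
assert (L0 : 0 <= L) by (eapply Rle_trans; [apply Rabs_pos | apply (HL s Hs)]).
assert (B2 : forall x, l <= x <= z -> Rabs (d2e x) <= L * (z - l)).
{ intros x Hx.
  assert (B := bounded_derive_lipschitz d2e (fun x => 0 - d3u x) l z L y x Hd2e).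
  rewrite E3, Rminus_0_r in B.
  eapply Rle_trans; [apply B; try lra|].
  - intros; rewrite Rminus_0_l, Rabs_Ropp; apply HL; lra.
  - apply Rmult_le_compat_l; [lra|]. apply Rabs_le; lra. }
assert (B := bounded_derive_lipschitz de d2e l z (L * (z - l)) x1 s Hde B2).
rewrite E1, Rminus_0_r in B.
eapply Rle_trans; [apply B; lra|].
rewrite <- Rsqr_pow2; unfold Rsqr; rewrite <- Rmult_assoc.
apply Rmult_le_compat_l; [nra | apply Rabs_le; lra].
Qed.

Lemma le_0_of_vanishing (A C p y0 : R) :
  0 < p -> 0 < y0 -> (forall y, 0 < y <= y0 -> A <= C * Rpower y p) -> A <= 0.
Proof.
intros Hp Hy0 H; apply Rnot_lt_le; intros HA.
assert (HC : 0 < C).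
{ specialize (H y0 ltac:(lra)); assert (P := Rpower_pos y0 p); nra. }
set (y := Rmin y0 (Rpower (A / (2 * C)) (/ p))).
assert (Hy : 0 < y) by (apply Rmin_pos; [lra | apply Rpower_pos]).
assert (Hyy : y <= y0) by apply Rmin_l.
specialize (H y ltac:(lra)).
assert (Q : Rpower y p <= A / (2 * C)).
{ assert (E : 0 < A / (2 * C)) by (apply Rdiv_lt_0_compat; lra).
  rewrite <- (Rpower_1 (A / (2 * C))) by exact E.
  rewrite <- (Rinv_l p) by lra; rewrite <- Rpower_mult.
  apply Rle_Rpower_l; [lra|]; split; [lra | apply Rmin_r]. }
apply (Rmult_le_compat_l C) in Q; [|lra].
replace (C * (A / (2 * C))) with (A / 2) in Q by (field; lra). lra.
Qed.

(* The choice [sigma = 1 - alpha / 2] makes [s - (l + r) / 2] orthogonal to the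
   kernel on [l, x]. *)
Lemma last_interval_lower (alpha sigma l r d D E : R) (g F : R -> R) :
  0 < alpha < 1 -> sigma = 1 - alpha / 2 -> l < r ->
  let x := l + sigma * (r - l) in
  (forall s, l <= s < x -> is_derive F s (Rpower (x - s) (- alpha) * g s)) ->
  (forall s, l <= s < x -> 0 <= F s) ->
  (forall s, l <= s < x -> Rabs (d + D * (s - (l + r) / 2) - g s) <= E) ->
  - F l - E * (Rpower (x - l) (1 - alpha) / (1 - alpha)) <=
  d * (Rpower (x - l) (1 - alpha) / (1 - alpha)).
Proof.
intros Ha Hs Hlr x HF HF0 HE.
assert (Hx : l < x) by (unfold x; nra).
assert (HE0 : 0 <= E) by (eapply Rle_trans; [apply Rabs_pos | apply (HE l); lra]).
set (be := 1 - alpha).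
set (A0 := fun s => - (Rpower (x - s) be / be)).
set (A1 := fun s => - ((x - (l + r) / 2) * Rpower (x - s) be / be)
                    + Rpower (x - s) (be + 1) / (be + 1)).
(* [A0] and [A1] are the primitives, vanishing at [x], of the kernel and of the kernel times
   [s - (l + r) / 2]. Hence [J] has a nonnegative derivative. It is compared at [l] and at [x - y]
   with [y] tending to 0, where [- F] is dropped by its sign. *)
set (J := fun s => (d + E) * A0 s + D * A1 s - F s).
assert (Dp : forall p s, l <= s < x ->
  is_derive (fun s => Rpower (x - s) p) s (- (p * Rpower (x - s) (p - 1)))).
{ intros p s Hs'.
  replace (- (p * Rpower (x - s) (p - 1)))
    with (scal (-1) (p * Rpower (x - s) (p - 1)))
    by (unfold scal; simpl; unfold mult; simpl; ring).
  apply (is_derive_comp (fun y => Rpower y p) (fun s => x - s)).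
  - apply is_derive_Rpower; lra.
  - auto_derive; trivial; ring. }
assert (HJ : forall s, l <= s < x -> is_derive J s
  (Rpower (x - s) (- alpha) * (d + E + D * (s - (l + r) / 2) - g s))).
{ intros s Hs'; unfold J, A0, A1.
  assert (P1 := Dp be s Hs'). assert (P2 := Dp (be + 1) s Hs').
  replace (be - 1) with (- alpha) in P1 by (unfold be; ring).
  replace (be + 1 - 1) with (- alpha + 1) in P2 by (unfold be; ring).
  rewrite Rpower_plus, Rpower_1 in P2 by lra.
  assert (Hbe : be <> 0) by (unfold be; lra).
  assert (Hbe1 : be + 1 <> 0) by (unfold be; lra).
  set (k := Rpower (x - s) (- alpha)) in *.
  apply (is_derive_ext (fun s =>
     minus (plus (scal (- ((d + E) / be + D * (x - (l + r) / 2) / be)) (Rpower (x - s) be))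
                 (scal (D / (be + 1)) (Rpower (x - s) (be + 1)))) (F s))).
  { intros y; unfold minus, plus, opp, scal; simpl; unfold mult; simpl; field; auto. }
  replace (k * (d + E + D * (s - (l + r) / 2) - g s)) with
     (minus (plus (scal (- ((d + E) / be + D * (x - (l + r) / 2) / be)) (- (be * k)))
                 (scal (D / (be + 1)) (- ((be + 1) * (k * (x - s)))))) (k * g s))
   by (unfold minus, plus, opp, scal; simpl; unfold mult; simpl; field; auto).
  apply @is_derive_minus; [apply @is_derive_plus|].
  - apply (is_derive_scal (fun y => Rpower (x - y) be)), P1.
  - apply (is_derive_scal (fun y => Rpower (x - y) (be + 1))), P2.
  - apply HF, Hs'. }
assert (Jmono : forall s, l < s < x -> J l <= J s).
{ intros s Hs'.
  destruct (MVT_cor2 J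
    (fun s => Rpower (x - s) (- alpha) * (d + E + D * (s - (l + r) / 2) - g s)) l s)
    as (c & Hc & Hc'); [lra | |].
  - intros y Hy; apply is_derive_Reals, HJ; lra.
  - specialize (HE c ltac:(lra)); apply Rabs_le_between in HE.
    assert (P := Rpower_pos (x - c) (- alpha)).
    assert (0 <= Rpower (x - c) (- alpha) * (d + E + D * (c - (l + r) / 2) - g c) * (s - l)).
    { apply Rmult_le_pos; [apply Rmult_le_pos; lra | lra]. }
    lra. }
assert (A1l : A1 l = 0).
{ unfold A1; rewrite Rpower_plus, Rpower_1 by lra.
  unfold be, x; rewrite Hs; field; lra. }
assert (Hbe : 0 < be) by (unfold be; lra).
assert (HJl : J l <= 0).
{ apply (le_0_of_vanishing (J l)
    (Rabs (d + E) / be + Rabs D * (Rabs (x - (l + r) / 2) / be + (x - l) / (be + 1)))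
    be ((x - l) / 2)); [lra | lra |].
  intros y Hy.
  specialize (Jmono (x - y) ltac:(lra)). specialize (HF0 (x - y) ltac:(lra)).
  eapply Rle_trans; [exact Jmono|]. unfold J, A0, A1.
  replace (x - (x - y)) with y by ring.
  rewrite Rpower_plus, Rpower_1 by lra.
  set (k := Rpower y be). assert (Hk : 0 < k) by apply Rpower_pos.
  assert (K1 : (d + E) * - (k / be) <= Rabs (d + E) / be * k).
  { replace ((d + E) * - (k / be)) with (- (d + E) * (k / be)) by ring.
    replace (Rabs (d + E) / be * k) with (Rabs (d + E) * (k / be)) by (field; lra).
    apply Rmult_le_compat_r; [apply Rlt_le, Rdiv_lt_0_compat; lra|].
    rewrite <- Rabs_Ropp; apply Rle_abs. }
  assert (K2 : D * (- ((x - (l + r) / 2) * k / be) + k * y / (be + 1)) <=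
     Rabs D * (Rabs (x - (l + r) / 2) / be + (x - l) / (be + 1)) * k).
  { eapply Rle_trans; [apply Rle_abs|].
    rewrite Rabs_mult, Rmult_assoc.
    apply Rmult_le_compat_l; [apply Rabs_pos|].
    eapply Rle_trans; [apply Rabs_triang|].
    rewrite Rmult_plus_distr_r; apply Rplus_le_compat.
    - rewrite Rabs_Ropp.
      replace ((x - (l + r) / 2) * k / be) with ((x - (l + r) / 2) * (k / be))
        by (field; lra).
      rewrite Rabs_mult, (Rabs_pos_eq (k / be))
        by (apply Rlt_le, Rdiv_lt_0_compat; lra).
      right; field; lra.
    - rewrite Rabs_pos_eq
        by (apply Rlt_le, Rdiv_lt_0_compat; [apply Rmult_lt_0_compat|]; lra).
      unfold Rdiv; rewrite (Rmult_comm k y), !(Rmult_assoc _ _ (/ (be + 1))),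
        (Rmult_assoc _ _ k), (Rmult_comm (/ (be + 1)) k).
      apply Rmult_le_compat_r; [|lra].
      apply Rmult_le_pos; [lra | apply Rlt_le, Rinv_0_lt_compat; lra]. }
  lra. }
unfold J in HJl; rewrite A1l in HJl; unfold A0 in HJl.
fold be; lra.
Qed.

(** * Consistency for shifted powers *)

Lemma is_derive_shifted_Rpower (a p s : R) :
  0 < s + a ->
  is_derive (fun s => Rpower (s + a) p) s (p * Rpower (s + a) (p - 1)).
Proof.
intros Hs.
replace (p * Rpower (s + a) (p - 1)) with (scal 1 (p * Rpower (s + a) (p - 1)))
  by (unfold scal; simpl; unfold mult; simpl; ring).
apply (is_derive_comp (fun y => Rpower y p) (fun s => s + a)).
- apply is_derive_Rpower, Hs.
- auto_derive; trivial; ring.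
Qed.

Lemma is_derive_scaled_Rpower (a c p s : R) :
  0 < s + a ->
  is_derive (fun s => c * Rpower (s + a) p) s (c * p * Rpower (s + a) (p - 1)).
Proof.
intros Hs; rewrite Rmult_assoc.
apply (is_derive_scal (fun s => Rpower (s + a) p)), is_derive_shifted_Rpower, Hs.
Qed.

Lemma shifted_power_interpolation (alpha a l r z s : R) :
  0 < alpha < 1 -> 0 < l + a -> l < r < z -> l <= s <= z ->
  let u := fun s => Rpower (s + a) (alpha - 1) in
  let d := (u r - u l) / (r - l) in
  let d' := (u z - u r) / (z - r) in
  Rabs (d + 2 / (z - l) * (d' - d) * (s - (l + r) / 2)
        - (alpha - 1) * Rpower (s + a) (alpha - 2)) <=
  6 * Rpower (l + a) (alpha - 4) * (z - l) ^ 2.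
Proof.
intros Ha Hla Hlr Hs u d d'.
apply (quadratic_interpolation_derive u
  (fun s => (alpha - 1) * Rpower (s + a) (alpha - 2))
  (fun s => (alpha - 1) * (alpha - 2) * Rpower (s + a) (alpha - 3))
  (fun s => (alpha - 1) * (alpha - 2) * (alpha - 3) * Rpower (s + a) (alpha - 4))
  l r z); try lra; intros y Hy.
- replace (alpha - 2) with (alpha - 1 - 1) by ring.
  apply is_derive_shifted_Rpower; lra.
- replace (alpha - 3) with (alpha - 2 - 1) by ring.
  apply is_derive_scaled_Rpower; lra.
- replace (alpha - 4) with (alpha - 3 - 1) by ring.
  apply is_derive_scaled_Rpower; lra.
- assert (P := Rpower_pos (y + a) (alpha - 4)).
  assert (Q : Rpower (y + a) (alpha - 4) <= Rpower (l + a) (alpha - 4))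
    by (apply Rpower_le_anti; lra).
  assert (W : 0 <= (1 - alpha) * (2 - alpha) * (3 - alpha) <= 6).
  { split; [apply Rmult_le_pos; nra|].
    assert (0 <= (1 - alpha) * (2 - alpha) <= 2) by nra. nra. }
  rewrite Rabs_left1; nra.
Qed.

(* Makes the fractional derivative of the shifted power [(s + a)^(alpha - 1)]
   explicit. *)
Lemma is_derive_primitive (alpha a x s : R) :
  0 < s + a -> s < x ->
  is_derive (fun s => Rpower ((x - s) / (s + a)) (1 - alpha) / (x + a)) s
    (Rpower (x - s) (- alpha) * ((alpha - 1) * Rpower (s + a) (alpha - 2))).
Proof.
intros Hsa Hsx.
assert (Hq : 0 < (x - s) / (s + a)) by (apply Rdiv_lt_0_compat; lra).
apply (is_derive_ext (fun s => scal (/ (x + a)) (Rpower ((x - s) / (s + a)) (1 - alpha)))).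
{ intros; unfold scal; simpl; unfold mult; simpl; unfold Rdiv; ring. }
replace (Rpower (x - s) (- alpha) * ((alpha - 1) * Rpower (s + a) (alpha - 2)))
  with (scal (/ (x + a)) (scal (- (x + a) / (s + a) ^ 2)
     ((1 - alpha) * Rpower ((x - s) / (s + a)) (1 - alpha - 1)))).
- apply (is_derive_scal (fun s => Rpower ((x - s) / (s + a)) (1 - alpha))).
  apply (is_derive_comp (fun y => Rpower y (1 - alpha)) (fun s => (x - s) / (s + a))).
  + apply is_derive_Rpower, Hq.
  + auto_derive; [lra | field; lra].
- unfold scal; simpl; unfold mult; simpl.
  replace (1 - alpha - 1) with (- alpha) by ring.
  unfold Rdiv at 2; rewrite <- Rpower_mult_distr by (try apply Rinv_0_lt_compat; lra).
  replace (Rpower (/ (s + a)) (- alpha)) with (Rpower (s + a) (alpha - 2) * (s + a) ^ 2).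
  + field; lra.
  + rewrite <- (Rpower_pow 2), <- Rpower_plus by lra.
    unfold Rpower; f_equal. rewrite ln_Rinv by lra. simpl; ring.
Qed.

Definition shifted_power (alpha a : R) (t : nat -> R) (j : nat) : R :=
  match j with O => 0 | S _ => Rpower (t j + a) (alpha - 1) end.

Section Consistency.

Context (alpha sigma T : R) (N : nat) (t : nat -> R).
Context (Halpha : 0 < alpha < 1) (Hsigma : sigma = 1 - alpha / 2).
Context (Hmesh : mesh T N t).

(** Interval length times the bound of [shifted_power_interpolation] for the nodes [t j], [t (S j)],
    [z]. *)
Definition local_error (a : R) (j : nat) (z : R) : R :=
  (t (S j) - t j) * (6 * Rpower (t j + a) (alpha - 4) * (z - t j) ^ 2).

(** On the earlier intervals the error of the derivative has mean zero, so only kernel increments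
    multiply it. The last interval carries the whole kernel integral; its third node is a fictitious
    one, a full step beyond [t (S k)], so that the formula also makes sense at the end of the
    mesh. *)
Definition consistency_error (a : R) (k : nat) : R :=
  let x := tstar sigma t (S k) in
  sum_n_m (fun i =>
     (Rpower (x - t i) (- alpha) - Rpower (x - t (i - 1)%nat) (- alpha))
     * local_error a (i - 1) (t (S i))) 1 k
  + sigma / (1 - alpha) * Rpower (x - t k) (- alpha)
    * local_error a k (t (S k) + (t (S k) - t k)).

(** The primitive [F] of the exact integrand telescopes over the intervals, and its value at [t k]
    cancels against the last interval. What remains is the jump contribution minus [F 0], together
    with the errors. *)
Lemma shifted_power_lower (a : R) (k : nat) :
  0 < a -> (k < N)%nat ->
  let x := tstar sigma t (S k) in
  Rpower a alpha * Rpower x (- alpha) / (x + a) - consistency_error a k <=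
  Gamma (1 - alpha) * alikhanov alpha sigma t (shifted_power alpha a t) (S k).
Proof.
intros Ha Hk x.
assert (HG := Gamma_1_alpha_pos alpha Halpha).
assert (Ht0 : t 0%nat = 0) by apply Hmesh.
assert (Hx := tstar_between alpha sigma T N t Halpha Hsigma Hmesh k Hk). fold x in Hx.
assert (Htk := mesh_le T N t 0 k Hmesh ltac:(lia)). rewrite Ht0 in Htk.
set (u := fun s => Rpower (s + a) (alpha - 1)).
set (F := fun s => Rpower ((x - s) / (s + a)) (1 - alpha) / (x + a)).
assert (Hjump : alikhanov alpha sigma t (shifted_power alpha a t) (S k) =
  alikhanov alpha sigma t (fun j => u (t j)) (S k) + coef_g alpha sigma t k 0 * u 0).
{ unfold alikhanov; rewrite !(sum_Sn_m _ 1 (S k)) by lia.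
  replace (S k - 1)%nat with k by lia. unfold plus; simpl (_ - _)%nat; simpl.
  unfold u; rewrite Ht0.
  rewrite (sum_n_m_ext_loc _ (fun j : nat =>
      coef_g alpha sigma t k (j - 1) *
      (Rpower (t j + a) (alpha - 1) - Rpower (t (j - 1)%nat + a) (alpha - 1)))).
  - ring.
  - intros j Hj; destruct j as [|[|j]]; try lia. simpl; reflexivity. }
rewrite Hjump, Rmult_plus_distr_l, <- Rmult_assoc.
assert (Hg := coef_g_lower alpha sigma T N t Halpha Hsigma Hmesh k 0 ltac:(lia)).
fold x in Hg; rewrite Ht0, Rminus_0_r in Hg.
rewrite (alikhanov_slopes alpha sigma T N t Hmesh) by exact Hk.
set (d := slope t (fun j => u (t j))).
(* The scheme is linear here, but any multiple of [s - (t k + t (S k)) / 2] may be added at no cost,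
   being orthogonal to the kernel. The multiple chosen completes the quadratic interpolant through
   the fictitious node and so gains an order. *)
assert (Hlast : - F (t k) - sigma / (1 - alpha) * Rpower (x - t k) (- alpha)
    * local_error a k (t (S k) + (t (S k) - t k)) <=
  Gamma (1 - alpha) * (coef_a alpha sigma t k k * d k)).
{ rewrite <- Rmult_assoc, (coef_a_diag alpha sigma T N t Halpha Hsigma Hmesh) by exact Hk.
  fold x.
  assert (Hl := last_interval_lower alpha sigma (t k) (t (S k)) (d k)
    (2 / (t (S k) + (t (S k) - t k) - t k) *
      ((u (t (S k) + (t (S k) - t k)) - u (t (S k))) /
         (t (S k) + (t (S k) - t k) - t (S k)) - d k))
    (6 * Rpower (t k + a) (alpha - 4) * (t (S k) + (t (S k) - t k) - t k) ^ 2)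
    (fun s => (alpha - 1) * Rpower (s + a) (alpha - 2)) F Halpha Hsigma
    ltac:(lra)).
  cbv zeta in Hl. rewrite <- tstar_S in Hl; fold x in Hl.
  assert (Hxk : x - t k = sigma * (t (S k) - t k)) by (unfold x; rewrite tstar_S; ring).
  replace (sigma / (1 - alpha) * Rpower (x - t k) (- alpha) *
     local_error a k (t (S k) + (t (S k) - t k))) with
   (6 * Rpower (t k + a) (alpha - 4) * (t (S k) + (t (S k) - t k) - t k) ^ 2
     * (Rpower (x - t k) (1 - alpha) / (1 - alpha))).
  2: { replace (1 - alpha) with (- alpha + 1) at 1 by ring.
       rewrite Rpower_plus, Rpower_1 by lra. rewrite Hxk at 2.
       unfold local_error; field; lra. }
  rewrite (Rmult_comm (Rpower (x - t k) (1 - alpha) / (1 - alpha)) (d k)).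
  apply Hl.
  - intros s Hs; apply is_derive_primitive; lra.
  - intros s Hs; unfold F; apply Rlt_le, Rdiv_lt_0_compat; [apply Rpower_pos | lra].
  - intros s Hs; apply (shifted_power_interpolation alpha a (t k) (t (S k))
      (t (S k) + (t (S k) - t k)) s); lra. }
assert (Hstep : forall j, (j < k)%nat ->
  F (t (S j)) - F (t j)
  - (Rpower (x - t (S j)) (- alpha) - Rpower (x - t j) (- alpha))
    * local_error a j (t (S (S j))) <=
  Gamma (1 - alpha) * (coef_a alpha sigma t k j * d j
     + coef_b alpha sigma t k j * (d (S j) - d j))).
{ intros j Hj.
  assert (H0 := mesh_le T N t 0 j Hmesh ltac:(lia)). rewrite Ht0 in H0.
  assert (H1 := mesh_step_pos T N t j Hmesh ltac:(lia)).
  assert (H2 := mesh_step_pos T N t (S j) Hmesh ltac:(lia)).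
  assert (H3 := mesh_le T N t (S j) k Hmesh ltac:(lia)).
  rewrite Rmult_plus_distr_l, <- !Rmult_assoc.
  rewrite (coef_a_lt alpha sigma t Halpha) by exact Hj.
  rewrite (coef_b_lt alpha sigma t Halpha).
  assert (Hi := kernel_interpolation_lower alpha x (t j) (t (S j)) (d j)
    (2 / (t (S (S j)) - t j) * (d (S j) - d j))
    (6 * Rpower (t j + a) (alpha - 4) * (t (S (S j)) - t j) ^ 2)
    (fun s => (alpha - 1) * Rpower (s + a) (alpha - 2)) F u
    ltac:(lra) ltac:(lra)).
  fold x.
  replace ((Rpower (x - t (S j)) (- alpha) - Rpower (x - t j) (- alpha))
    * local_error a j (t (S (S j)))) with
   ((Rpower (x - t (S j)) (- alpha) - Rpower (x - t j) (- alpha)) * (t (S j) - t j) *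
     (6 * Rpower (t j + a) (alpha - 4) * (t (S (S j)) - t j) ^ 2))
   by (unfold local_error; ring).
  eapply Rle_trans; [apply Hi|].
  - intros s Hs; apply is_derive_primitive; lra.
  - intros s Hs; unfold u.
    replace (alpha - 2) with (alpha - 1 - 1) by ring.
    apply is_derive_shifted_Rpower; lra.
  - intros s Hs.
    apply (ex_derive_continuous (fun s => (alpha - 1) * Rpower (s + a) (alpha - 2))).
    eexists; apply is_derive_scaled_Rpower; lra.
  - unfold d, slope; field; lra.
  - intros s Hs.
    apply (shifted_power_interpolation alpha a (t j) (t (S j)) (t (S (S j))) s); lra.
  - right; ring. }
assert (Hsum : forall p, (p <= k)%nat ->
  F (t p) - F 0 - sum_n_m (fun i =>
     (Rpower (x - t i) (- alpha) - Rpower (x - t (i - 1)%nat) (- alpha))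
     * local_error a (i - 1) (t (S i))) 1 p <=
  Gamma (1 - alpha) * sum_n_m (fun i => coef_a alpha sigma t k (i - 1) * d (i - 1)%nat
     + coef_b alpha sigma t k (i - 1) * (d i - d (i - 1)%nat)) 1 p).
{ induction p as [|p IH]; intros Hp.
  - rewrite !sum_n_m_zero by lia; unfold zero; simpl; rewrite Ht0; lra.
  - rewrite !sum_n_Sm by lia; unfold plus; simpl; rewrite !Nat.sub_0_r.
    specialize (IH ltac:(lia)). specialize (Hstep p ltac:(lia)). lra. }
specialize (Hsum k ltac:(lia)).
(* The difference of the jump term and [F 0] is the exact fractional derivative, up to the factor
   [Gamma (1 - alpha)]. *)
assert (HF0 : Rpower a alpha * Rpower x (- alpha) / (x + a) =
              Rpower x (- alpha) * u 0 - F 0).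
{ unfold u, F; rewrite Rplus_0_l, Rminus_0_r.
  unfold Rdiv at 3; rewrite <- Rpower_mult_distr by (try apply Rinv_0_lt_compat; lra).
  replace (Rpower x (1 - alpha)) with (Rpower x (- alpha) * x)
    by (replace (1 - alpha) with (- alpha + 1) by ring;
        rewrite Rpower_plus, Rpower_1; lra).
  replace (Rpower (/ a) (1 - alpha)) with (Rpower a (alpha - 1))
    by (unfold Rpower; f_equal; rewrite ln_Rinv by lra; ring).
  replace (Rpower a alpha) with (Rpower a (alpha - 1) * a)
    by (replace alpha with (alpha - 1 + 1) at 2 by ring;
        rewrite Rpower_plus, Rpower_1; lra).
  field; lra. }
assert (Hu0 : 0 < u 0) by apply Rpower_pos.
rewrite HF0; unfold consistency_error; fold x. cbv zeta.
rewrite (Rmult_plus_distr_l (Gamma (1 - alpha))).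
assert (Rpower x (- alpha) * u 0 <= Gamma (1 - alpha) * coef_g alpha sigma t k 0 * u 0)
  by (apply Rmult_le_compat_r; lra).
lra.
Qed.

End Consistency.

(** * Quasi-graded meshes *)

Lemma Rpower_base_1 (p : R) : Rpower 1 p = 1.
Proof. unfold Rpower; rewrite ln_1, Rmult_0_r; apply exp_0. Qed.

Lemma Rpower_ge_1 (x p : R) : 1 <= x -> 0 <= p -> 1 <= Rpower x p.
Proof. intros Hx Hp; rewrite <- (Rpower_base_1 p); apply Rle_Rpower_l; lra. Qed.

Lemma Rpower_div (x y p : R) :
  0 < x -> 0 < y -> Rpower (x / y) p = Rpower x p * Rpower y (- p).
Proof.
intros Hx Hy; unfold Rdiv.
rewrite <- Rpower_mult_distr by (try apply Rinv_0_lt_compat; lra).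
unfold Rpower; f_equal; f_equal; rewrite ln_Rinv by lra; ring.
Qed.

Section QuasiGraded.

Context (K r T : R) (N : nat) (t : nat -> R).
Context (Hr : 1 <= r) (Hmesh : mesh T N t) (Hqg : quasi_graded K r N t).

Lemma first_step : tau t 1 = t 1%nat.
Proof. rewrite tau_S, (proj1 (proj2 Hmesh)); ring. Qed.

Lemma first_step_pos : 0 < tau t 1.
Proof. rewrite tau_S; assert (H := mesh_step_pos T N t 0 Hmesh (proj1 Hmesh)); lra. Qed.

Lemma mesh_pos (j : nat) : (1 <= j <= N)%nat -> tau t 1 <= t j.
Proof. intros Hj; rewrite first_step; apply (mesh_le T N); [exact Hmesh | lia]. Qed.

Lemma quasi_graded_const : 1 <= K.
Proof.
assert (HN := proj1 Hmesh). assert (P := first_step_pos).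
destruct Hqg as [_ H]. destruct (H 1%nat ltac:(lia)) as [[H1 _] _].
rewrite INR_1, Rpower_base_1, Rmult_1_r, <- first_step in H1. nra.
Qed.

(** Bounds [t (S n) / t n]: two uses of the grading relation give [K ^ 2], and [n + 1 <= 2 n] gives
    the power of 2. *)
Let Kt := K ^ 2 * Rpower 2 r.

Lemma ratio_const_ge_1 : 1 <= Kt.
Proof.
assert (HK := quasi_graded_const).
assert (H2 := Rpower_ge_1 2 r ltac:(lra) ltac:(lra)).
unfold Kt; assert (1 <= K ^ 2) by nra; nra.
Qed.

Lemma mesh_ratio (n : nat) : (1 <= n < N)%nat -> t (S n) <= Kt * t n.
Proof.
intros Hn; assert (HK := quasi_graded_const). assert (P := first_step_pos).
destruct Hqg as [_ H].
destruct (H n ltac:(lia)) as [[_ H1] _]. destruct (H (S n) ltac:(lia)) as [[H2 _] _].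
assert (Hn1 : 1 <= INR n) by (rewrite <- INR_1; apply le_INR; lia).
assert (H3 : Rpower (INR (S n)) r <= Rpower 2 r * Rpower (INR n) r).
{ rewrite Rpower_mult_distr by lra. apply Rle_Rpower_l; [lra|].
  rewrite S_INR; lra. }
assert (P2 := Rpower_pos 2 r).
unfold Kt; eapply Rle_trans; [exact H2|].
apply Rle_trans with (K * (tau t 1 * (Rpower 2 r * Rpower (INR n) r))).
- apply Rmult_le_compat_l; [lra|]; apply Rmult_le_compat_l; lra.
- replace (K * (tau t 1 * (Rpower 2 r * Rpower (INR n) r)))
    with (K * Rpower 2 r * (tau t 1 * Rpower (INR n) r)) by ring.
  replace (K ^ 2 * Rpower 2 r * t n) with (K * Rpower 2 r * (K * t n)) by ring.
  apply Rmult_le_compat_l; [nra | exact H1].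
Qed.

(** The step size that the grading prescribes at time [y], extended to all positive [y] so that it
    can be evaluated at shifted arguments [t + a]. *)
Let scale (y : R) := Rpower (tau t 1) (1 / r) * Rpower y (1 - 1 / r).

Lemma step_exponent : 0 <= 1 - 1 / r < 1.
Proof.
assert (0 < 1 / r) by (apply Rdiv_lt_0_compat; lra).
assert (1 / r <= 1) by (apply (Rmult_le_reg_r r); [lra|]; unfold Rdiv; rewrite Rmult_assoc, Rinv_l; lra).
lra.
Qed.

Lemma scale_le (y y' : R) : 0 < y <= y' -> scale y <= scale y'.
Proof.
intros Hy; unfold scale; apply Rmult_le_compat_l; [apply Rlt_le, Rpower_pos|].
apply Rle_Rpower_l; [apply step_exponent | lra].
Qed.

Lemma scale_mult (c y : R) : 1 <= c -> 0 < y -> scale (c * y) <= c * scale y.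
Proof.
intros Hc Hy; unfold scale; rewrite <- Rpower_mult_distr by lra.
assert (Rpower c (1 - 1 / r) <= c).
{ rewrite <- (Rpower_1 c) at 2 by lra. apply Rle_Rpower; [lra|].
  assert (S := step_exponent); lra. }
assert (P1 := Rpower_pos (tau t 1) (1 / r)).
assert (P2 := Rpower_pos y (1 - 1 / r)).
replace (Rpower (tau t 1) (1 / r) * (Rpower c (1 - 1 / r) * Rpower y (1 - 1 / r)))
  with (Rpower c (1 - 1 / r) * (Rpower (tau t 1) (1 / r) * Rpower y (1 - 1 / r))) by ring.
apply Rmult_le_compat_r; [nra | lra].
Qed.

Lemma step_scale (j : nat) :
  (j < N)%nat ->
  t (S j) - t j <= K * scale (t (S j)) /\ scale (t (S j)) <= K * (t (S j) - t j).
Proof.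
intros Hj; destruct Hqg as [_ H]; destruct (H (S j) ltac:(lia)) as [_ [H1 H2]].
rewrite (tau_S t j) in H1, H2; split; assumption.
Qed.

Lemma step_ratio (n : nat) :
  (S n < N)%nat -> t (S (S n)) - t (S n) <= K ^ 2 * Kt * (t (S n) - t n).
Proof.
intros Hn; assert (HK := quasi_graded_const). assert (HKt := ratio_const_ge_1).
assert (Hp := mesh_pos (S n) ltac:(lia)). assert (P := first_step_pos).
assert (Hp' := mesh_pos (S (S n)) ltac:(lia)).
eapply Rle_trans; [apply step_scale; lia|].
assert (H1 := mesh_ratio (S n) ltac:(lia)).
assert (H2 := scale_le (t (S (S n))) (Kt * t (S n)) ltac:(lra)).
assert (H3 := scale_mult Kt (t (S n)) HKt ltac:(lra)).
destruct (step_scale n ltac:(lia)) as [_ H4].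
replace (K ^ 2 * Kt * (t (S n) - t n)) with (K * (Kt * (K * (t (S n) - t n)))) by ring.
apply Rmult_le_compat_l; [lra|].
eapply Rle_trans; [exact H2|]. eapply Rle_trans; [exact H3|].
apply Rmult_le_compat_l; lra.
Qed.

Definition local_error_const (alpha : R) : R :=
  6 * (1 + K ^ 2 * Kt) ^ 2 * K ^ 3 * Rpower (Kt + 1) (4 - alpha).

(** With step [h] the error is of size [h^3 (t + a)^(alpha - 4)], and [h] is at most a multiple of
    [scale (t + a)]; inserting the cube of the latter produces both exponents. *)
Lemma local_error_bound (alpha a z : R) (j : nat) :
  0 < alpha < 1 -> tau t 1 <= a -> (j < N)%nat ->
  t (S j) < z -> z - t j <= (1 + K ^ 2 * Kt) * (t (S j) - t j) ->
  local_error alpha t a j z <=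
  local_error_const alpha * Rpower (tau t 1) (3 / r)
    * Rpower (t (S j) + a) (- (1 + 3 / r - alpha)).
Proof.
intros Ha Hta Hj Hz1 Hz2.
assert (HK := quasi_graded_const). assert (HKt := ratio_const_ge_1).
assert (P := first_step_pos). assert (Hp := mesh_pos (S j) ltac:(lia)).
assert (Hst := mesh_step_pos T N t j Hmesh Hj).
assert (Ht0 : 0 <= t j).
{ rewrite <- (proj1 (proj2 Hmesh)); apply (mesh_le T N); [exact Hmesh | lia]. }
set (h := t (S j) - t j) in *. assert (Hh : 0 < h) by (unfold h; lra).
(* The ratio of mesh points is unbounded at [j = 0]; there [tau t 1 <= a] takes its place. *)
assert (R1 : t (S j) + a <= (Kt + 1) * (t j + a)).
{ destruct j as [|j].
  - assert (E := proj1 (proj2 Hmesh)); simpl in E.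
    assert (F := first_step); simpl in F. nra.
  - assert (H1 := mesh_ratio (S j) ltac:(lia)). nra. }
assert (R2 : Rpower (t j + a) (alpha - 4) <=
             Rpower (Kt + 1) (4 - alpha) * Rpower (t (S j) + a) (alpha - 4)).
{ replace (Rpower (t j + a) (alpha - 4)) with
    (Rpower (Kt + 1) (4 - alpha) * Rpower ((Kt + 1) * (t j + a)) (alpha - 4)).
  - apply Rmult_le_compat_l; [apply Rlt_le, Rpower_pos|].
    apply Rpower_le_anti; lra.
  - rewrite <- Rpower_mult_distr, <- Rmult_assoc, <- Rpower_plus by lra.
    replace (4 - alpha + (alpha - 4)) with 0 by ring.
    rewrite Rpower_O by lra; ring. }
assert (R3 : h <= K * scale (t (S j) + a)).
{ eapply Rle_trans; [apply step_scale, Hj|].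
  apply Rmult_le_compat_l; [lra|]; apply scale_le; lra. }
assert (R4 : h ^ 3 <= K ^ 3 * scale (t (S j) + a) ^ 3).
{ rewrite <- Rpow_mult_distr; apply pow_incr; lra. }
assert (R5 : scale (t (S j) + a) ^ 3 * Rpower (t (S j) + a) (alpha - 4) =
  Rpower (tau t 1) (3 / r) * Rpower (t (S j) + a) (- (1 + 3 / r - alpha))).
{ unfold scale; rewrite Rpow_mult_distr, <- !Rpower_pow by apply Rpower_pos.
  rewrite !Rpower_mult, Rmult_assoc, <- Rpower_plus.
  simpl INR; f_equal; f_equal; field; lra. }
assert (P2 := Rpower_pos (t j + a) (alpha - 4)).
assert (P3 := Rpower_pos (t (S j) + a) (alpha - 4)).
assert (P4 := Rpower_pos (Kt + 1) (4 - alpha)).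
unfold local_error, local_error_const; fold h.
replace (6 * (1 + K ^ 2 * Kt) ^ 2 * K ^ 3 * Rpower (Kt + 1) (4 - alpha) *
   Rpower (tau t 1) (3 / r) * Rpower (t (S j) + a) (- (1 + 3 / r - alpha)))
 with (6 * (1 + K ^ 2 * Kt) ^ 2 * (K ^ 3 * scale (t (S j) + a) ^ 3)
   * (Rpower (Kt + 1) (4 - alpha) * Rpower (t (S j) + a) (alpha - 4))).
2: { transitivity (6 * (1 + K ^ 2 * Kt) ^ 2 * K ^ 3 * Rpower (Kt + 1) (4 - alpha) *
       (scale (t (S j) + a) ^ 3 * Rpower (t (S j) + a) (alpha - 4)));
       [ring | rewrite R5; ring]. }
apply Rle_trans with
  (6 * (1 + K ^ 2 * Kt) ^ 2 * h ^ 3 * Rpower (t j + a) (alpha - 4)).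
- assert (Z : (z - t j) ^ 2 <= ((1 + K ^ 2 * Kt) * h) ^ 2)
    by (apply pow_incr; unfold h in *; lra).
  replace (h * (6 * Rpower (t j + a) (alpha - 4) * (z - t j) ^ 2))
    with (6 * h * Rpower (t j + a) (alpha - 4) * (z - t j) ^ 2) by ring.
  replace (6 * (1 + K ^ 2 * Kt) ^ 2 * h ^ 3 * Rpower (t j + a) (alpha - 4))
    with (6 * h * Rpower (t j + a) (alpha - 4) * ((1 + K ^ 2 * Kt) * h) ^ 2) by ring.
  apply Rmult_le_compat_l; [|exact Z].
  apply Rmult_le_pos; lra.
- assert (0 <= h ^ 3) by (apply pow_le; lra).
  assert (0 <= (1 + K ^ 2 * Kt) ^ 2) by apply pow2_ge_0.
  apply Rmult_le_compat; [| lra | | exact R2].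
  + apply Rmult_le_pos; lra.
  + apply Rmult_le_compat_l; lra.
Qed.

End QuasiGraded.

(** * Summing the truncation error *)

Lemma negative_power_increment (y y' p : R) :
  0 < p -> 0 < y <= y' ->
  p * (y' - y) * Rpower y' (- p - 1) <= Rpower y (- p) - Rpower y' (- p) <=
  p * (y' - y) * Rpower y (- p - 1).
Proof.
intros Hp [Hy [Hlt | ->]]; [|split; lra].
destruct (MVT_cor2 (fun s => Rpower s (- p))
            (fun s => - p * Rpower s (- p - 1)) y y' Hlt) as (c & Hc & Hc').
{ intros c Hc; apply derivable_pt_lim_power; lra. }
assert (K1 : Rpower c (- p - 1) <= Rpower y (- p - 1)) by (apply Rpower_le_anti; lra).
assert (K2 : Rpower y' (- p - 1) <= Rpower c (- p - 1)) by (apply Rpower_le_anti; lra).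
replace (Rpower y (- p) - Rpower y' (- p)) with (p * (y' - y) * Rpower c (- p - 1)) by lra.
split; apply Rmult_le_compat_l; try lra; apply Rmult_le_pos; lra.
Qed.

Section KernelSums.

Context (T : R) (N : nat) (t : nat -> R) (Hmesh : mesh T N t).

Lemma mesh_nonneg (j : nat) : (j <= N)%nat -> 0 <= t j.
Proof.
intros Hj; rewrite <- (proj1 (proj2 Hmesh)).
apply (mesh_le T N); [exact Hmesh | lia].
Qed.

(** The right-endpoint Riemann sum of [(s + a)^(-q)] over [[0, t p]]. *)
Definition power_sum (a q : R) (p : nat) : R :=
  sum_n_m (fun i => (t i - t (i - 1)%nat) * Rpower (t i + a) (- q)) 1 p.

Lemma power_sum_S (a q : R) (p : nat) :
  power_sum a q (S p) =
  power_sum a q p + (t (S p) - t p) * Rpower (t (S p) + a) (- q).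
Proof.
unfold power_sum; rewrite sum_n_Sm by lia; unfold plus; simpl.
rewrite Nat.sub_0_r; reflexivity.
Qed.

Lemma power_sum_0 (a q : R) : power_sum a q 0 = 0.
Proof. unfold power_sum; rewrite sum_n_m_zero by lia; reflexivity. Qed.

(** Two estimates of the sum, by length times maximum and by the integral over the half-line, are
    merged through the factor [x / (x + a)]: the first serves for [x <= a], the second for
    [x > a]. *)
Lemma power_sum_bound (a q x : R) (p : nat) :
  0 < a -> 1 < q -> (p <= N)%nat -> 0 < x -> t p <= x ->
  power_sum a q p <= (2 + 2 / (q - 1)) * Rpower a (1 - q) * (x / (x + a)).
Proof.
intros Ha Hq HpN Hx Hpx.
assert (H : power_sum a q p <= t p * Rpower a (- q) /\
  (q - 1) * power_sum a q p <= Rpower a (1 - q) - Rpower (t p + a) (1 - q)).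
{ clear x Hx Hpx; induction p as [|p IH].
  - rewrite power_sum_0, (proj1 (proj2 Hmesh)), Rplus_0_l; lra.
  - rewrite power_sum_S; destruct (IH ltac:(lia)) as [IH1 IH2].
    assert (H0 := mesh_nonneg p ltac:(lia)).
    assert (H1 := mesh_step_pos T N t p Hmesh ltac:(lia)).
    assert (H2 : Rpower (t (S p) + a) (- q) <= Rpower a (- q))
      by (apply Rpower_le_anti; lra).
    destruct (negative_power_increment (t p + a) (t (S p) + a) (q - 1)) as [H3 _]; try lra.
    replace (- (q - 1) - 1) with (- q) in H3 by ring.
    replace (- (q - 1)) with (1 - q) in H3 by ring.
    split; nra. }
destruct H as [H1 H2].
assert (P1 := Rpower_pos a (1 - q)). assert (P2 := Rpower_pos (t p + a) (1 - q)).
assert (Q : 0 < 2 / (q - 1)) by (apply Rdiv_lt_0_compat; lra).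
assert (X : 0 < x / (x + a)) by (apply Rdiv_lt_0_compat; lra).
destruct (Rle_dec x a) as [Hxa | Hxa].
- assert (E : Rpower a (1 - q) = Rpower a (- q) * a).
  { replace (1 - q) with (- q + 1) by ring; rewrite Rpower_plus, Rpower_1 by lra; ring. }
  assert (P3 := Rpower_pos a (- q)).
  apply Rle_trans with (x * Rpower a (- q)); [nra|].
  apply Rle_trans with (2 * Rpower a (1 - q) * (x / (x + a)));
    [|apply Rmult_le_compat_r; [|apply Rmult_le_compat_r]; lra].
  rewrite E.
  apply (Rmult_le_reg_r (x + a)); [lra|].
  replace (2 * (Rpower a (- q) * a) * (x / (x + a)) * (x + a))
    with (x * Rpower a (- q) * (2 * a)) by (field; lra).
  apply Rmult_le_compat_l; [apply Rmult_le_pos; lra | lra].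
- apply Rle_trans with (Rpower a (1 - q) / (q - 1)).
  + apply (Rmult_le_reg_l (q - 1)); [lra|].
    replace ((q - 1) * (Rpower a (1 - q) / (q - 1))) with (Rpower a (1 - q)) by (field; lra).
    lra.
  + assert (X2 : / 2 <= x / (x + a)).
    { apply (Rmult_le_reg_r (x + a)); [lra|].
      unfold Rdiv; rewrite Rmult_assoc, Rinv_l by lra; lra. }
    apply Rle_trans with (2 / (q - 1) * Rpower a (1 - q) * / 2).
    * right; field; lra.
    * apply Rmult_le_compat; [apply Rmult_le_pos; lra | lra | | exact X2].
      apply Rmult_le_compat_r; lra.
Qed.

(** Split at [x / 2]. In the half near [x] the power is comparable to [(x + a)^(-q)] and the kernel
    increments telescope; in the other half the kernel has slope at most a multiple of
    [x^(-alpha-1)], which leaves [power_sum]. *)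
Lemma kernel_sum_split (alpha a q x : R) (k : nat) :
  0 < alpha < 1 -> 0 < a -> 0 < q -> (k <= N)%nat -> t k < x -> 0 < x ->
  sum_n_m (fun i => (Rpower (x - t i) (- alpha) - Rpower (x - t (i - 1)%nat) (- alpha))
                    * Rpower (t i + a) (- q)) 1 k <=
  Rpower 2 q * Rpower (x + a) (- q) * Rpower (x - t k) (- alpha)
  + Rpower 2 (alpha + 1) * Rpower x (- alpha - 1) * power_sum a q k.
Proof.
intros Ha Haa Hq HkN Hkx Hx.
set (f := fun s => Rpower (x - s) (- alpha)).
set (c1 := Rpower 2 q * Rpower (x + a) (- q)).
set (c2 := Rpower 2 (alpha + 1) * Rpower x (- alpha - 1)).
assert (C1 : 0 < c1) by (apply Rmult_lt_0_compat; apply Rpower_pos).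
assert (C2 : 0 < c2) by (apply Rmult_lt_0_compat; apply Rpower_pos).
enough (H : forall p, (p <= k)%nat ->
  sum_n_m (fun i => (f (t i) - f (t (i - 1)%nat)) * Rpower (t i + a) (- q)) 1 p <=
  c1 * (f (t p) - f 0) + c2 * power_sum a q p).
{ specialize (H k ltac:(lia)). assert (F0 := Rpower_pos (x - 0) (- alpha)).
  fold (f 0) in F0. fold (f (t k)). unfold f in H at 1 2. nra. }
induction p as [|p IH]; intros Hp.
- rewrite power_sum_0, sum_n_m_zero, (proj1 (proj2 Hmesh)) by lia.
  unfold zero; simpl; lra.
- specialize (IH ltac:(lia)).
  rewrite sum_n_Sm, power_sum_S by lia; unfold plus; simpl; rewrite Nat.sub_0_r.
  assert (H0 := mesh_nonneg p ltac:(lia)).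
  assert (H1 := mesh_step_pos T N t p Hmesh ltac:(lia)).
  assert (H2 := mesh_le T N t (S p) k Hmesh ltac:(lia)).
  assert (P := Rpower_pos (t (S p) + a) (- q)).
  assert (Fm : f (t p) <= f (t (S p))) by (apply kernel_mono; lra).
  enough (Hs : (f (t (S p)) - f (t p)) * Rpower (t (S p) + a) (- q) <=
    c1 * (f (t (S p)) - f (t p)) + c2 * ((t (S p) - t p) * Rpower (t (S p) + a) (- q)))
    by lra.
  assert (N2 : 0 <= c2 * ((t (S p) - t p) * Rpower (t (S p) + a) (- q))).
  { apply Rmult_le_pos; [lra|]; apply Rmult_le_pos; lra. }
  destruct (Rle_dec (x / 2) (t (S p))) as [Hh | Hh].
  + assert (Hc : Rpower (t (S p) + a) (- q) <= c1).
    { apply Rle_trans with (Rpower ((x + a) / 2) (- q)); [apply Rpower_le_anti; lra|].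
      right; unfold c1; rewrite Rpower_div, Ropp_involutive by lra; ring. }
    nra.
  + destruct (negative_power_increment (x - t (S p)) (x - t p) alpha) as [_ Hi]; try lra.
    assert (Hc : Rpower (x - t (S p)) (- alpha - 1) <= c2).
    { apply Rle_trans with (Rpower (x / 2) (- alpha - 1)); [apply Rpower_le_anti; lra|].
      right; unfold c2; rewrite Rpower_div by lra.
      replace (- (- alpha - 1)) with (alpha + 1) by ring; ring. }
    fold (f (t p)) (f (t (S p))) in Hi.
    assert (Hd : f (t (S p)) - f (t p) <= (t (S p) - t p) * c2).
    { eapply Rle_trans; [exact Hi|].
      replace (x - t p - (x - t (S p))) with (t (S p) - t p) by ring.
      assert (P' := Rpower_pos (x - t (S p)) (- alpha - 1)).
      apply Rle_trans with (1 * (t (S p) - t p) * c2); [|lra].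
      apply Rmult_le_compat; try lra; nra. }
    nra.
Qed.

End KernelSums.

Lemma sum_n_m_le_loc (F H : nat -> R) (k : nat) :
  (forall i, (1 <= i <= k)%nat -> F i <= H i) -> sum_n_m F 1 k <= sum_n_m H 1 k.
Proof.
induction k as [|k IH]; intros Hi.
- rewrite !sum_n_m_zero by lia; lra.
- rewrite !sum_n_Sm by lia; unfold plus; simpl.
  apply Rplus_le_compat; [apply IH; intros; apply Hi; lia | apply Hi; lia].
Qed.

Section ErrorBound.

Context (alpha sigma K r T : R) (N : nat) (t : nat -> R).
Context (Halpha : 0 < alpha < 1) (Hsigma : sigma = 1 - alpha / 2).
Context (Hr : 1 <= r) (Hra : r <= (3 - alpha) / alpha).
Context (Hmesh : mesh T N t) (Hqg : quasi_graded K r N t).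

Let q := 1 + 3 / r - alpha.

Definition error_const : R :=
  local_error_const K r alpha *
  ((Rpower 2 q + sigma / (1 - alpha)) * Rpower (sigma / K) (- alpha)
   + Rpower 2 (alpha + 1) * (2 + 2 / (q - 1))).

Lemma alpha_le_order : alpha <= (3 - alpha) / r.
Proof.
apply (Rmult_le_reg_r r); [lra|].
replace ((3 - alpha) / r * r) with (3 - alpha) by (field; lra).
apply (Rmult_le_compat_l alpha) in Hra; [|lra].
replace (alpha * ((3 - alpha) / alpha)) with (3 - alpha) in Hra by (field; lra).
lra.
Qed.

Lemma three_over_r_gt : alpha < 3 / r.
Proof.
assert (H := alpha_le_order).
replace (3 / r) with ((3 - alpha) / r + alpha / r) by (field; lra).
assert (0 < alpha / r) by (apply Rdiv_lt_0_compat; lra). lra.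
Qed.

Lemma consistency_error_bound (a : R) (k : nat) :
  tau t 1 <= a -> (k < N)%nat ->
  let x := tstar sigma t (S k) in
  consistency_error alpha sigma t a k <=
  error_const * (Rpower (tau t 1) alpha * Rpower x (- alpha) / (x + a)).
Proof.
intros Hta Hk x.
assert (P := first_step_pos T N t Hmesh).
assert (HK := quasi_graded_const K r T N t Hmesh Hqg).
assert (HKt := ratio_const_ge_1 K r T N t Hr Hmesh Hqg).
assert (Hx := tstar_between alpha sigma T N t Halpha Hsigma Hmesh k Hk). fold x in Hx.
assert (Htk := mesh_nonneg T N t Hmesh k ltac:(lia)).
assert (Ho := alpha_le_order). assert (Ho' := three_over_r_gt).
assert (Hq : 1 < q) by (unfold q; lra).
set (CL := local_error_const K r alpha).
assert (HCL : 0 < CL).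
{ unfold CL, local_error_const. set (c := 1 + K ^ 2 * (K ^ 2 * Rpower 2 r)).
  assert (0 < c) by (unfold c; nra).
  apply Rmult_lt_0_compat; [|apply Rpower_pos].
  apply Rmult_lt_0_compat; [|apply pow_lt; lra].
  apply Rmult_lt_0_compat; [lra | apply pow_lt; lra]. }
set (A := CL * Rpower (tau t 1) (3 / r)).
assert (HA : 0 < A) by (apply Rmult_lt_0_compat; [lra | apply Rpower_pos]).
set (f := fun s => Rpower (x - s) (- alpha)).
assert (Hs : 0 < sigma / (1 - alpha)) by (apply Rdiv_lt_0_compat; lra).
assert (Hfk : 0 < f (t k)) by apply Rpower_pos.
assert (S1 : sum_n_m (fun i => (f (t i) - f (t (i - 1)%nat))
               * local_error alpha t a (i - 1) (t (S i))) 1 k <=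
  A * sum_n_m (fun i => (f (t i) - f (t (i - 1)%nat)) * Rpower (t i + a) (- q)) 1 k).
{ rewrite <- (sum_n_m_mult_l (K := R_Ring) A). apply sum_n_m_le_loc.
  intros i Hi; destruct i as [|i]; [lia|].
  unfold mult; simpl; rewrite Nat.sub_0_r.
  assert (H1 := mesh_step_pos T N t i Hmesh ltac:(lia)).
  assert (H2 := mesh_step_pos T N t (S i) Hmesh ltac:(lia)).
  assert (H3 := mesh_le T N t (S i) k Hmesh ltac:(lia)).
  assert (H4 := step_ratio K r T N t Hr Hmesh Hqg i ltac:(lia)).
  assert (Hl := local_error_bound K r T N t Hr Hmesh Hqg alpha a (t (S (S i))) i
                  Halpha Hta ltac:(lia) H2 ltac:(lra)).
  fold q in Hl; fold CL in Hl; fold A in Hl.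
  assert (Fm : f (t i) <= f (t (S i))) by (apply kernel_mono; lra).
  replace (A * ((f (t (S i)) - f (t i)) * Rpower (t (S i) + a) (- q)))
    with ((f (t (S i)) - f (t i)) * (A * Rpower (t (S i) + a) (- q))) by ring.
  apply Rmult_le_compat_l; lra. }
assert (S2 : local_error alpha t a k (t (S k) + (t (S k) - t k)) <=
             A * Rpower (x + a) (- q)).
{ assert (1 <= K ^ 2 * (K ^ 2 * Rpower 2 r)) by (assert (1 <= K ^ 2) by nra; nra).
  eapply Rle_trans;
    [apply (local_error_bound K r T N t Hr Hmesh Hqg alpha a _ k Halpha Hta Hk); nra|].
  fold q; fold CL; fold A; apply Rmult_le_compat_l; [lra|].
  apply Rpower_le_anti; lra. }
assert (S3 := kernel_sum_split T N t Hmesh alpha a q x k Halpha ltac:(lra) ltac:(lra)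
                ltac:(lia) ltac:(lra) ltac:(lra)).
assert (S4 := power_sum_bound T N t Hmesh a q x k ltac:(lra) Hq ltac:(lia)
                ltac:(lra) ltac:(lra)).
fold (f (t k)) in S3.
set (m := Rpower (tau t 1) alpha * Rpower x (- alpha) / (x + a)).
assert (Hm : 0 < m).
{ apply Rdiv_lt_0_compat; [|lra]. apply Rmult_lt_0_compat; apply Rpower_pos. }
(* The singular factor [f (t k)] is controlled by [x - t k = sigma (t (S k) - t k)] and the grading.
   The surviving power of [x + a] has exponent [alpha - (3 - alpha) / r]; it is nonpositive exactly
   by the restriction on [r], so [x + a] may be lowered to [tau t 1]. *)
assert (Near : Rpower (tau t 1) (3 / r) * (Rpower (x + a) (- q) * f (t k)) <=
               Rpower (sigma / K) (- alpha) * m).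
{ assert (Hf : f (t k) <= Rpower (sigma / K) (- alpha) *
     (Rpower (tau t 1) (- (alpha / r)) * (Rpower x (- alpha) * Rpower x (alpha / r)))).
  { replace (Rpower (tau t 1) (- (alpha / r)) * (Rpower x (- alpha) * Rpower x (alpha / r)))
      with (Rpower (Rpower (tau t 1) (1 / r) * Rpower x (1 - 1 / r)) (- alpha)).
    - rewrite Rpower_mult_distr;
        [|apply Rdiv_lt_0_compat; lra |apply Rmult_lt_0_compat; apply Rpower_pos].
      apply Rpower_le_anti; [|lra]. split.
      + apply Rmult_lt_0_compat; [apply Rdiv_lt_0_compat; lra|].
        apply Rmult_lt_0_compat; apply Rpower_pos.
      + assert (E : x - t k = sigma * (t (S k) - t k))
          by (unfold x; rewrite tstar_S; ring).
        rewrite E.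
        destruct (step_scale K r N t Hqg k Hk) as [_ H1].
        assert (H2 := scale_le r t Hr x (t (S k)) ltac:(lra)).
        apply Rle_trans with (sigma / K * (K * (t (S k) - t k))).
        * apply Rmult_le_compat_l; [apply Rlt_le, Rdiv_lt_0_compat; lra | lra].
        * right; field; lra.
    - rewrite <- Rpower_mult_distr by apply Rpower_pos.
      rewrite !Rpower_mult, <- Rpower_plus.
      f_equal; f_equal; field; lra. }
  assert (B1 : Rpower x (alpha / r) <= Rpower (x + a) (alpha / r)).
  { apply Rle_Rpower_l; [apply Rlt_le, Rdiv_lt_0_compat; lra | lra]. }
  assert (B2 : Rpower (x + a) (alpha - (3 - alpha) / r) <=
               Rpower (tau t 1) (alpha - (3 - alpha) / r))
    by (apply Rpower_le_anti; lra).
  assert (Q1 := Rpower_pos (sigma / K) (- alpha)).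
  assert (Q2 := Rpower_pos (tau t 1) (- (alpha / r))).
  assert (Q3 := Rpower_pos x (- alpha)).
  assert (Q4 := Rpower_pos (x + a) (- q)).
  assert (Q5 := Rpower_pos (tau t 1) (3 / r)).
  apply Rle_trans with (Rpower (tau t 1) (3 / r) * (Rpower (x + a) (- q) *
    (Rpower (sigma / K) (- alpha) *
     (Rpower (tau t 1) (- (alpha / r)) *
       (Rpower x (- alpha) * Rpower (x + a) (alpha / r)))))).
  { apply Rmult_le_compat_l; [lra|]. apply Rmult_le_compat_l; [lra|].
    eapply Rle_trans; [exact Hf|].
    apply Rmult_le_compat_l; [lra|]. apply Rmult_le_compat_l; [lra|].
    apply Rmult_le_compat_l; [lra | exact B1]. }
  replace (Rpower (tau t 1) (3 / r) * (Rpower (x + a) (- q) *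
    (Rpower (sigma / K) (- alpha) *
     (Rpower (tau t 1) (- (alpha / r)) *
       (Rpower x (- alpha) * Rpower (x + a) (alpha / r))))))
   with (Rpower (sigma / K) (- alpha) * (Rpower x (- alpha) / (x + a) *
     (Rpower (tau t 1) ((3 - alpha) / r) * Rpower (x + a) (alpha - (3 - alpha) / r)))).
  2: { replace ((3 - alpha) / r) with (3 / r + - (alpha / r)) at 1 by (field; lra).
       replace (alpha - (3 - alpha) / r) with (- q + (alpha / r) + 1)
         by (unfold q; field; lra).
       rewrite !Rpower_plus, (Rpower_1 (x + a)) by lra. field; lra. }
  apply Rmult_le_compat_l; [lra|].
  unfold m; replace (Rpower (tau t 1) alpha * Rpower x (- alpha) / (x + a))
    with (Rpower x (- alpha) / (x + a) * Rpower (tau t 1) alpha) by (field; lra).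
  apply Rmult_le_compat_l; [apply Rlt_le, Rdiv_lt_0_compat; lra|].
  apply Rle_trans with (Rpower (tau t 1) ((3 - alpha) / r)
                        * Rpower (tau t 1) (alpha - (3 - alpha) / r)).
  - apply Rmult_le_compat_l; [apply Rlt_le, Rpower_pos | exact B2].
  - rewrite <- Rpower_plus; right; f_equal; ring. }
(* Here the exponent of [a] is [alpha - 3 / r < 0], so [a] may be lowered to [tau t 1]. *)
assert (Far : Rpower (tau t 1) (3 / r) *
     (Rpower x (- alpha - 1) * (Rpower a (1 - q) * (x / (x + a)))) <= m).
{ assert (B : Rpower a (alpha - 3 / r) <= Rpower (tau t 1) (alpha - 3 / r))
    by (apply Rpower_le_anti; lra).
  assert (Q3 := Rpower_pos x (- alpha)).
  replace (Rpower (tau t 1) (3 / r) *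
     (Rpower x (- alpha - 1) * (Rpower a (1 - q) * (x / (x + a)))))
   with (Rpower x (- alpha) / (x + a) *
         (Rpower (tau t 1) (3 / r) * Rpower a (alpha - 3 / r))).
  2: { replace (1 - q) with (alpha - 3 / r) by (unfold q; ring).
       replace (Rpower x (- alpha)) with (Rpower x (- alpha - 1) * x); [field; lra|].
       replace (- alpha) with (- alpha - 1 + 1) at 2 by ring.
       rewrite Rpower_plus, Rpower_1 by lra; reflexivity. }
  unfold m; replace (Rpower (tau t 1) alpha * Rpower x (- alpha) / (x + a))
    with (Rpower x (- alpha) / (x + a) * Rpower (tau t 1) alpha) by (field; lra).
  apply Rmult_le_compat_l; [apply Rlt_le, Rdiv_lt_0_compat; lra|].
  apply Rle_trans with (Rpower (tau t 1) (3 / r) * Rpower (tau t 1) (alpha - 3 / r)).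
  - apply Rmult_le_compat_l; [apply Rlt_le, Rpower_pos | exact B].
  - rewrite <- Rpower_plus; right; f_equal; ring. }
unfold consistency_error; fold x; cbv zeta; fold (f (t k)).
apply Rle_trans with
  (A * (Rpower 2 q * Rpower (x + a) (- q) * f (t k)
        + Rpower 2 (alpha + 1) * Rpower x (- alpha - 1) *
          ((2 + 2 / (q - 1)) * Rpower a (1 - q) * (x / (x + a))))
   + sigma / (1 - alpha) * f (t k) * (A * Rpower (x + a) (- q))).
- apply Rplus_le_compat.
  + eapply Rle_trans; [exact S1|].
    apply Rmult_le_compat_l; [lra|]. eapply Rle_trans; [exact S3|].
    apply Rplus_le_compat_l, Rmult_le_compat_l; [|exact S4].
    apply Rlt_le, Rmult_lt_0_compat; apply Rpower_pos.
  + apply Rmult_le_compat_l; [|exact S2]. apply Rmult_le_pos; lra.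
- replace (A * (Rpower 2 q * Rpower (x + a) (- q) * f (t k)
        + Rpower 2 (alpha + 1) * Rpower x (- alpha - 1) *
          ((2 + 2 / (q - 1)) * Rpower a (1 - q) * (x / (x + a))))
   + sigma / (1 - alpha) * f (t k) * (A * Rpower (x + a) (- q)))
   with (CL * ((Rpower 2 q + sigma / (1 - alpha)) *
      (Rpower (tau t 1) (3 / r) * (Rpower (x + a) (- q) * f (t k)))
    + Rpower 2 (alpha + 1) * (2 + 2 / (q - 1)) *
     (Rpower (tau t 1) (3 / r) *
     (Rpower x (- alpha - 1) * (Rpower a (1 - q) * (x / (x + a)))))))
   by (unfold A; ring).
  unfold error_const; fold CL; rewrite (Rmult_assoc CL).
  apply Rmult_le_compat_l; [lra|].
  rewrite (Rmult_plus_distr_r _ _ m); apply Rplus_le_compat.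
  + rewrite (Rmult_assoc _ _ m); apply Rmult_le_compat_l; [|exact Near].
    assert (Q := Rpower_pos 2 q); lra.
  + apply Rmult_le_compat_l; [|exact Far].
    assert (0 < 2 / (q - 1)) by (apply Rdiv_lt_0_compat; lra).
    apply Rmult_le_pos; [apply Rlt_le, Rpower_pos | lra].
Qed.

(** The lower bound on [a] says [2 * error_const * tau_1^alpha <= a^alpha], so the error takes at
    most half of the main term. The factor 1 in the maximum ensures [tau t 1 <= a]. *)
Lemma shifted_power_supersolution (a : R) (k : nat) :
  Rmax 1 (Rpower (2 * error_const) (/ alpha)) * tau t 1 <= a -> (k < N)%nat ->
  Rpower a alpha * Rpower (t (S k)) (- alpha) / (t (S k) + a) <=
  2 * Gamma (1 - alpha) * alikhanov alpha sigma t (shifted_power alpha a t) (S k).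
Proof.
intros Ha Hk.
assert (P := first_step_pos T N t Hmesh).
set (B := Rpower (2 * error_const) (/ alpha)) in *.
assert (M1 := Rmax_l 1 B). assert (M2 := Rmax_r 1 B).
assert (Ha1 : tau t 1 <= a) by nra.
assert (HB : 0 < B) by apply Rpower_pos.
assert (Ha2 : B * tau t 1 <= a) by nra.
set (x := tstar sigma t (S k)).
assert (Hx := tstar_between alpha sigma T N t Halpha Hsigma Hmesh k Hk). fold x in Hx.
assert (Htk := mesh_nonneg T N t Hmesh k ltac:(lia)).
assert (L := shifted_power_lower alpha sigma T N t Halpha Hsigma Hmesh a k ltac:(lra) Hk).
assert (E := consistency_error_bound a k Ha1 Hk).
fold x in L, E; cbv zeta in L, E.
set (m := Rpower x (- alpha) / (x + a)).
assert (Hm : 0 < m) by (apply Rdiv_lt_0_compat; [apply Rpower_pos | lra]).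
replace (Rpower a alpha * Rpower x (- alpha) / (x + a)) with (Rpower a alpha * m) in L
  by (unfold m; field; lra).
replace (Rpower (tau t 1) alpha * Rpower x (- alpha) / (x + a))
  with (Rpower (tau t 1) alpha * m) in E by (unfold m; field; lra).
assert (Hpa := Rpower_pos a alpha). assert (Hpt := Rpower_pos (tau t 1) alpha).
assert (Hsmall : 2 * error_const * Rpower (tau t 1) alpha <= Rpower a alpha).
{ destruct (Rle_dec error_const 0) as [Hn | Hn]; [nra|].
  apply Rle_trans with (Rpower (B * tau t 1) alpha).
  - rewrite <- Rpower_mult_distr by lra. unfold B.
    rewrite Rpower_mult, Rinv_l, Rpower_1 by lra; lra.
  - apply Rle_Rpower_l; [lra|]. split; [apply Rmult_lt_0_compat|]; lra. }
apply Rle_trans with (Rpower a alpha * m).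
- unfold m, Rdiv; rewrite Rmult_assoc; apply Rmult_le_compat_l; [lra|].
  apply Rmult_le_compat; try (apply Rlt_le, Rpower_pos).
  + apply Rlt_le, Rinv_0_lt_compat; lra.
  + apply Rpower_le_anti; lra.
  + apply Rinv_le_contravar; lra.
- assert (2 * error_const * Rpower (tau t 1) alpha * m <= Rpower a alpha * m)
    by (apply Rmult_le_compat_r; lra).
  lra.
Qed.

End ErrorBound.

(** * Barriers without reaction terms *)

Lemma Rpower_2_gt_1 (p : R) : 0 < p -> 1 < Rpower 2 p.
Proof. intros Hp; rewrite <- (Rpower_O 2) by lra; apply Rpower_lt; lra. Qed.

(** Writes a term of a geometric series as a difference, so that dyadic sums can be bounded by
    induction with a telescoping remainder. *)
Lemma geometric_step (b p : R) :
  0 < b -> 0 < p ->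
  Rpower (2 * b) (- p) = / (Rpower 2 p - 1) * (Rpower b (- p) - Rpower (2 * b) (- p)).
Proof.
intros Hb Hp.
assert (H2 := Rpower_2_gt_1 p Hp).
rewrite <- Rpower_mult_distr, Rpower_Ropp by lra. field; lra.
Qed.

(** A discrete form of the integral of [a^(-gamma) w(a)] against [da / a], sampled at
    [a = A * 2^i]. *)
Fixpoint dyadic_sum (A gamma : R) (w : R -> R) (n : nat) : R :=
  Rpower (A * 2 ^ n) (- gamma) * w (A * 2 ^ n)
  + match n with O => 0 | S n' => dyadic_sum A gamma w n' end.

Lemma dyadic_pos (A : R) (n : nat) : 0 < A -> 0 < A * 2 ^ n.
Proof. intros HA; apply Rmult_lt_0_compat; [lra | apply pow_lt; lra]. Qed.

Lemma dyadic_sum_ge (A gamma : R) (w : R -> R) (n i : nat) :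
  (forall m, 0 <= w (A * 2 ^ m)) -> (i <= n)%nat ->
  Rpower (A * 2 ^ i) (- gamma) * w (A * 2 ^ i) <= dyadic_sum A gamma w n.
Proof.
intros Hw Hin.
assert (Hnn : forall m, 0 <= Rpower (A * 2 ^ m) (- gamma) * w (A * 2 ^ m)).
{ intros m; apply Rmult_le_pos; [apply Rlt_le, Rpower_pos | apply Hw]. }
assert (Hs : forall m, 0 <= dyadic_sum A gamma w m).
{ induction m as [|m IH]; simpl dyadic_sum.
  - specialize (Hnn 0%nat); simpl in *; lra.
  - specialize (Hnn (S m)); simpl in *; lra. }
induction Hin as [|n Hin IH].
- destruct i as [|i]; simpl dyadic_sum; [simpl; lra|].
  specialize (Hs i). simpl in *; lra.
- simpl dyadic_sum. specialize (Hnn (S n)); simpl in *; lra.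
Qed.

Lemma dyadic_sum_upper_pos (A gamma alpha s : R) (n : nat) :
  0 < A -> 0 < gamma -> alpha < 1 -> 0 < s ->
  dyadic_sum A gamma (fun b => Rpower (s + b) (alpha - 1)) n <=
  (1 + / (Rpower 2 gamma - 1)) * Rpower A (- gamma) * Rpower s (alpha - 1).
Proof.
intros HA Hg Ha Hs.
assert (H2 := Rpower_2_gt_1 gamma Hg).
set (D := / (Rpower 2 gamma - 1)).
assert (HD : 0 < D) by (apply Rinv_0_lt_compat; lra).
assert (Hterm : forall m, Rpower (A * 2 ^ m) (- gamma) * Rpower (s + A * 2 ^ m) (alpha - 1)
                  <= Rpower (A * 2 ^ m) (- gamma) * Rpower s (alpha - 1)).
{ intros m; assert (P := dyadic_pos A m HA).
  apply Rmult_le_compat_l; [apply Rlt_le, Rpower_pos | apply Rpower_le_anti; lra]. }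
assert (Ps := Rpower_pos s (alpha - 1)).
enough (H : dyadic_sum A gamma (fun b => Rpower (s + b) (alpha - 1)) n <=
   ((1 + D) * Rpower A (- gamma) - D * Rpower (A * 2 ^ n) (- gamma)) * Rpower s (alpha - 1)).
{ eapply Rle_trans; [exact H|]. apply Rmult_le_compat_r; [lra|].
  assert (P := Rpower_pos (A * 2 ^ n) (- gamma)). nra. }
induction n as [|n IH]; simpl dyadic_sum.
- specialize (Hterm 0%nat); simpl in *. rewrite Rmult_1_r in *. lra.
- specialize (Hterm (S n)). assert (P := dyadic_pos A n HA).
  assert (E := geometric_step (A * 2 ^ n) gamma P Hg). fold D in E.
  replace (2 * (A * 2 ^ n)) with (A * 2 ^ S n) in E by (simpl; ring).
  change (A * (2 * 2 ^ n)) with (A * 2 ^ S n).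
  rewrite E in Hterm at 2. nra.
Qed.

(** The terms are dominated by a growing geometric progression while the shift is below [s] and by a
    decaying one beyond, so the terms near [s] dominate. The three constants account for the growing
    part, the crossing term and the tail. *)
Lemma dyadic_sum_upper_neg (A delta alpha s : R) (n : nat) :
  0 < A -> 0 < delta < 1 - alpha -> 0 < s ->
  dyadic_sum A (- delta) (fun b => Rpower (s + b) (alpha - 1)) n <=
  (/ (1 - Rpower 2 (- delta)) + 1 + / (Rpower 2 (1 - alpha - delta) - 1))
  * Rpower s (alpha - 1 + delta).
Proof.
intros HA Hd Hs.
set (p := 1 - alpha - delta). assert (Hp : 0 < p) by (unfold p; lra).
assert (H2p := Rpower_2_gt_1 p Hp).
assert (H2d := Rpower_2_gt_1 delta ltac:(lra)).
assert (H2d' : 0 < Rpower 2 (- delta) < 1).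
{ split; [apply Rpower_pos|]. rewrite Rpower_Ropp, <- Rinv_1.
  apply Rinv_lt_contravar; lra. }
set (C1 := / (1 - Rpower 2 (- delta))). set (C2 := / (Rpower 2 p - 1)).
assert (HC1 : 1 <= C1).
{ unfold C1; rewrite <- Rinv_1; apply Rinv_le_contravar; lra. }
assert (HC2 : 0 < C2) by (apply Rinv_0_lt_compat; lra).
assert (Hexp : Rpower s (alpha - 1 + delta) = Rpower s (- p))
  by (f_equal; unfold p; ring).
rewrite Hexp.
assert (Hterm : forall b, 0 < b -> Rpower b (- - delta) * Rpower (s + b) (alpha - 1)
                  <= Rpower b delta * Rpower s (alpha - 1)).
{ intros b Hb; rewrite Ropp_involutive.
  apply Rmult_le_compat_l; [apply Rlt_le, Rpower_pos | apply Rpower_le_anti; lra]. }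
assert (Hterm' : forall b, 0 < b -> Rpower b (- - delta) * Rpower (s + b) (alpha - 1)
                  <= Rpower b (- p)).
{ intros b Hb; rewrite Ropp_involutive.
  replace (- p) with (delta + (alpha - 1)) by (unfold p; ring); rewrite Rpower_plus.
  apply Rmult_le_compat_l; [apply Rlt_le, Rpower_pos | apply Rpower_le_anti; lra]. }
set (W := dyadic_sum A (- delta) (fun b => Rpower (s + b) (alpha - 1))).
assert (Ps := Rpower_pos s (alpha - 1)). assert (Psp := Rpower_pos s (- p)).
assert (Hss : Rpower s (alpha - 1) * Rpower s delta = Rpower s (- p))
  by (rewrite <- Rpower_plus; f_equal; unfold p; ring).
(* The two regimes of the induction. In the second, the subtracted multiple of [(A * 2^n)^(-p)] pays
   for the terms still to come. *)
assert (H : (A * 2 ^ n <= s /\ W n <= C1 * Rpower (A * 2 ^ n) delta * Rpower s (alpha - 1))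
  \/ (s < A * 2 ^ n /\ W n <= (C1 + 1 + C2) * Rpower s (- p)
                              - C2 * Rpower (A * 2 ^ n) (- p))).
{ induction n as [|n IH].
  - unfold W; simpl. rewrite Rmult_1_r.
    assert (T1 := Hterm A HA). assert (T2 := Hterm' A HA).
    assert (PA := Rpower_pos A delta).
    assert (PAs : 0 < Rpower A delta * Rpower s (alpha - 1))
      by (apply Rmult_lt_0_compat; lra).
    destruct (Rle_dec A s) as [Hle | Hlt]; [left | right]; split; try lra.
    + nra.
    + assert (Rpower A (- p) <= Rpower s (- p)) by (apply Rpower_le_anti; lra). nra.
  - assert (Hb := dyadic_pos A n HA).
    assert (T1 := Hterm (A * 2 ^ S n) (dyadic_pos A (S n) HA)).
    assert (T2 := Hterm' (A * 2 ^ S n) (dyadic_pos A (S n) HA)).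
    assert (WS : W (S n) = Rpower (A * 2 ^ S n) (- - delta)
              * Rpower (s + A * 2 ^ S n) (alpha - 1) + W n) by reflexivity.
    assert (E := geometric_step (A * 2 ^ n) p Hb Hp). fold C2 in E.
    assert (E1 : Rpower (A * 2 ^ n) delta = Rpower 2 (- delta) * Rpower (2 * (A * 2 ^ n)) delta).
    { rewrite <- (Rpower_mult_distr 2 (A * 2 ^ n)), <- Rmult_assoc, <- Rpower_plus by lra.
      rewrite Rplus_opp_l, Rpower_O by lra; ring. }
    replace (2 * (A * 2 ^ n)) with (A * 2 ^ S n) in E, E1 by (simpl; ring).
    assert (Hbb : A * 2 ^ n < A * 2 ^ S n).
    { replace (A * 2 ^ S n) with (2 * (A * 2 ^ n)) by (simpl; ring). lra. }
    set (b := A * 2 ^ n) in *. set (b' := A * 2 ^ S n) in *.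
    assert (PB := Rpower_pos b' delta).
    destruct (Rle_dec b' s) as [Hle | Hlt]; [left | right]; split; try lra.
    + destruct IH as [[_ IH] | [IH _]]; [|lra].
      rewrite WS. rewrite E1 in IH.
      assert (EC : C1 * Rpower 2 (- delta) + 1 = C1) by (unfold C1; field; lra).
      replace (C1 * Rpower b' delta * Rpower s (alpha - 1)) with
        ((C1 * Rpower 2 (- delta) + 1) * Rpower b' delta * Rpower s (alpha - 1))
        by (rewrite EC; reflexivity).
      lra.
    + destruct IH as [[Hbs IH] | [_ IH]].
      * assert (B1 : Rpower b delta <= Rpower s delta) by (apply Rle_Rpower_l; lra).
        assert (B2 : Rpower b' (- p) <= Rpower s (- p)) by (apply Rpower_le_anti; lra).
        assert (B3 : C1 * Rpower b delta * Rpower s (alpha - 1) <= C1 * Rpower s (- p)).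
        { rewrite <- Hss, Rmult_assoc, (Rmult_comm (Rpower b delta)).
          apply Rmult_le_compat_l; [lra|]. apply Rmult_le_compat_l; lra. }
        rewrite WS. nra.
      * rewrite WS. lra. }
destruct H as [[Hb H] | [_ H]]; (eapply Rle_trans; [exact H|]).
- assert (B1 : Rpower (A * 2 ^ n) delta <= Rpower s delta).
  { apply Rle_Rpower_l; [lra|]. split; [apply dyadic_pos|]; lra. }
  rewrite <- Hss, Rmult_assoc, (Rmult_comm (Rpower _ delta)).
  apply Rle_trans with (C1 * (Rpower s (alpha - 1) * Rpower s delta)).
  + apply Rmult_le_compat_l; [lra|]. apply Rmult_le_compat_l; lra.
  + apply Rmult_le_compat_r; [nra | lra].
- assert (P := Rpower_pos (A * 2 ^ n) (- p)). nra.
Qed.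

Definition admissible (alpha sigma K r T tau_max : R) (N : nat) (t : nat -> R) : Prop :=
  mesh T N t /\ quasi_graded K r N t /\ monotone_coefs alpha sigma N t /\
  max_step t N <= tau_max.

Definition has_barrier
    (alpha sigma K r T tau_max lambda1 lambda2 gamma : R) : Prop :=
  exists C, 0 < C /\
  forall N t, admissible alpha sigma K r T tau_max N t ->
  exists W : nat -> R, W 0%nat = 0 /\
  forall k, (k < N)%nat ->
    0 <= W (S k) <= C * barrier alpha gamma t (S k) /\
    Rpower (tau t 1 / t (S k)) (gamma + 1) <=
    alikhanov alpha sigma t W (S k) - lambda1 * W (S k) - lambda2 * W k.

Lemma dyadic_alikhanov (alpha sigma A gamma : R) (t : nat -> R) (n m : nat) :
  alikhanov alpha sigma t
    (fun j => dyadic_sum A gamma (fun b => shifted_power alpha b t j) n) m =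
  dyadic_sum A gamma (fun b => alikhanov alpha sigma t (shifted_power alpha b t) m) n.
Proof.
induction n as [|n IH].
(* The summand [0 * 0] brings a mere scaling into the form of [alikhanov_lin]. *)
- transitivity (alikhanov alpha sigma t (fun j => Rpower (A * 2 ^ 0) (- gamma)
     * shifted_power alpha (A * 2 ^ 0) t j + 0 * 0) m).
  + apply alikhanov_ext; intros; simpl; ring.
  + rewrite alikhanov_lin with (w := fun _ => 0); simpl; ring.
- transitivity (alikhanov alpha sigma t (fun j => Rpower (A * 2 ^ S n) (- gamma)
     * shifted_power alpha (A * 2 ^ S n) t j
     + 1 * dyadic_sum A gamma (fun b => shifted_power alpha b t j) n) m).
  + apply alikhanov_ext; intros; simpl; ring.
  + rewrite alikhanov_lin with
      (w := fun j => dyadic_sum A gamma (fun b => shifted_power alpha b t j) n).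
    rewrite IH; simpl; ring.
Qed.

Lemma dyadic_cover (A s : R) (n : nat) :
  0 < A -> s <= A * 2 ^ n ->
  exists i, (i <= n)%nat /\ s <= A * 2 ^ i <= Rmax A (2 * s).
Proof.
intros HA; induction n as [|n IH]; intros Hs.
- exists 0%nat; split; [lia|]; split; [exact Hs|].
  simpl; rewrite Rmult_1_r; apply Rmax_l.
- destruct (Rle_dec s (A * 2 ^ n)) as [Hle | Hgt].
  + destruct (IH Hle) as (i & Hi & H); exists i; split; [lia | exact H].
  + exists (S n); split; [lia|]; split; [exact Hs|].
    apply Rle_trans with (2 * s); [simpl; lra | apply Rmax_r].
Qed.

Lemma dyadic_exceeds (A T : R) : 0 < A -> exists n, T <= A * 2 ^ n.
Proof.
intros HA.
destruct (Pow_x_infinity 2 ltac:(rewrite Rabs_pos_eq; lra) (T / A)) as [n Hn].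
exists n; specialize (Hn n (le_n n)).
rewrite Rabs_pos_eq in Hn by (apply pow_le; lra).
apply Rge_le in Hn; apply (Rmult_le_compat_l A) in Hn; [|lra].
replace (A * (T / A)) with T in Hn by (field; lra). exact Hn.
Qed.

Lemma singular_barrier (alpha sigma K r T tau_max gamma : R) :
  0 < alpha < 1 -> sigma = 1 - alpha / 2 -> 1 <= r -> r <= (3 - alpha) / alpha ->
  alpha - 1 < gamma < alpha -> gamma <> 0 ->
  has_barrier alpha sigma K r T tau_max 0 0 gamma.
Proof.
intros Ha Hs Hr Hra Hg Hg0.
set (G := Gamma (1 - alpha)). assert (HG : 0 < G) by (apply Gamma_1_alpha_pos, Ha).
set (M := Rmax 1 (Rpower (2 * error_const alpha sigma K r) (/ alpha))).
assert (HM : 1 <= M) by apply Rmax_l.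
assert (Hup : exists C, 0 < C /\ forall A s n tau1, 0 < tau1 <= A -> tau1 <= s ->
  Rpower tau1 (gamma + 1) *
    dyadic_sum A gamma (fun b => Rpower (s + b) (alpha - 1)) n <=
  C * (tau1 * Rpower s (alpha - 1) * Rpower (tau1 / s) (Rmin 0 gamma))).
{ destruct (Rlt_dec 0 gamma) as [Hpos | Hneg].
  - exists (1 + / (Rpower 2 gamma - 1)).
    assert (H2 := Rpower_2_gt_1 gamma Hpos).
    assert (0 < / (Rpower 2 gamma - 1)) by (apply Rinv_0_lt_compat; lra).
    split; [lra|]. intros A s n tau1 HA Hts.
    assert (U := dyadic_sum_upper_pos A gamma alpha s n ltac:(lra) Hpos ltac:(lra) ltac:(lra)).
    rewrite Rmin_left, Rpower_O, Rmult_1_r by (try apply Rdiv_lt_0_compat; lra).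
    rewrite Rpower_plus, Rpower_1 by lra.
    assert (B : Rpower A (- gamma) <= Rpower tau1 (- gamma)) by (apply Rpower_le_anti; lra).
    assert (P1 := Rpower_pos tau1 gamma). assert (P2 := Rpower_pos s (alpha - 1)).
    apply Rle_trans with (Rpower tau1 gamma * tau1 *
       ((1 + / (Rpower 2 gamma - 1)) * Rpower tau1 (- gamma) * Rpower s (alpha - 1))).
    + apply Rmult_le_compat_l; [apply Rmult_le_pos; lra|].
      eapply Rle_trans; [exact U|]. apply Rmult_le_compat_r; [lra|].
      apply Rmult_le_compat_l; lra.
    + right; rewrite (Rpower_Ropp tau1). field; lra.
  - exists (/ (1 - Rpower 2 (- - gamma)) + 1 + / (Rpower 2 (1 - alpha - - gamma) - 1)).
    assert (H2 := Rpower_2_gt_1 (1 - alpha - - gamma) ltac:(lra)).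
    assert (0 < / (Rpower 2 (1 - alpha - - gamma) - 1)) by (apply Rinv_0_lt_compat; lra).
    assert (Rpower 2 (- - gamma) < 1).
    { rewrite <- (Rpower_O 2) by lra. apply Rpower_lt; lra. }
    assert (0 < / (1 - Rpower 2 (- - gamma))) by (apply Rinv_0_lt_compat; lra).
    split; [lra|]. intros A s n tau1 HA Hts.
    assert (U := dyadic_sum_upper_neg A (- gamma) alpha s n ltac:(lra) ltac:(lra) ltac:(lra)).
    rewrite Ropp_involutive in U at 1.
    rewrite Rmin_right, Rpower_div by lra.
    replace (tau1 * Rpower s (alpha - 1) * (Rpower tau1 gamma * Rpower s (- gamma)))
      with (Rpower tau1 (gamma + 1) * Rpower s (alpha - 1 + - gamma))
      by (rewrite !Rpower_plus, (Rpower_1 tau1) by lra; ring).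
    assert (P1 := Rpower_pos tau1 (gamma + 1)).
    eapply Rle_trans; [apply Rmult_le_compat_l; [lra | exact U]|].
    right; ring. }
destruct Hup as (C & HC & Hup).
(* The factor [2 * G] comes from [shifted_power_supersolution]. The shift [b] selected below
   satisfies [b <= (M + 2) * s], whence [s + b <= (M + 3) * s]. *)
set (c := 2 * G * (M + 3)). assert (Hc : 0 < c) by (unfold c; nra).
exists (c * C); split; [apply Rmult_lt_0_compat; lra|].
intros N t (Hmesh & Hqg & Hmono & _).
assert (P := first_step_pos T N t Hmesh).
set (A := M * tau t 1). assert (HA : tau t 1 <= A) by (unfold A; nra).
(* The number of scales may depend on the mesh, since the upper bounds on dyadic sums are uniform in
   it. *)
destruct (dyadic_exceeds A T ltac:(lra)) as [n Hn].
set (S0 := fun j => dyadic_sum A gamma (fun b => shifted_power alpha b t j) n).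
set (Z := c * Rpower (tau t 1) (gamma + 1)).
assert (HZ : 0 < Z) by (apply Rmult_lt_0_compat; [lra | apply Rpower_pos]).
exists (fun j => Z * S0 j + 0 * 0); split.
{ assert (E : forall m, dyadic_sum A gamma (fun b => shifted_power alpha b t 0) m = 0).
  { induction m as [|m IH]; simpl in *; [|rewrite IH]; ring. }
  unfold S0; rewrite E; ring. }
intros k Hk. set (s := t (S k)).
assert (Hs1 : tau t 1 <= s) by (apply (mesh_pos T N t Hmesh); lia).
split; [split|].
- assert (Hge := dyadic_sum_ge A gamma (fun b => shifted_power alpha b t (S k)) n 0
    ltac:(intros; apply Rlt_le, Rpower_pos) ltac:(lia)).
  assert (0 <= S0 (S k)).
  { eapply Rle_trans; [|exact Hge].
    apply Rmult_le_pos; apply Rlt_le, Rpower_pos. }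
  nra.
- unfold barrier; fold s. specialize (Hup A s n (tau t 1) ltac:(lra) Hs1).
  unfold Z; rewrite Rmult_0_l, Rplus_0_r, (Rmult_assoc c), (Rmult_assoc c C).
  apply Rmult_le_compat_l; [lra | exact Hup].
- rewrite alikhanov_lin with (w := fun _ => 0).
  unfold S0; rewrite dyadic_alikhanov.
  set (d := dyadic_sum A gamma _ n).
  assert (Hsol : forall m, Rpower (A * 2 ^ m) alpha * Rpower s (- alpha) / (s + A * 2 ^ m) <=
     2 * G * alikhanov alpha sigma t (shifted_power alpha (A * 2 ^ m) t) (S k)).
  { intros m; apply (shifted_power_supersolution alpha sigma K r T N t Ha Hs Hr Hra Hmesh Hqg);
      [|exact Hk].
    fold M; fold A. assert (1 <= 2 ^ m) by (apply pow_R1_Rle; lra). nra. }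
  assert (HsT : s <= A * 2 ^ n).
  { apply Rle_trans with T; [|exact Hn].
    rewrite <- (proj1 (proj2 (proj2 Hmesh))). apply (mesh_le T N); [exact Hmesh | lia]. }
  destruct (dyadic_cover A s n ltac:(lra) HsT) as (i & Hi & Hi1 & Hi2).
  assert (Hge := dyadic_sum_ge A gamma
    (fun b => alikhanov alpha sigma t (shifted_power alpha b t) (S k)) n i).
  cbv beta in Hge. fold d in Hge.
  set (b := A * 2 ^ i) in *.
  assert (Hb : b <= (M + 2) * s).
  { eapply Rle_trans; [exact Hi2|]. apply Rmax_lub; unfold A; nra. }
  (* Every shift contributes a positive amount, so the single one comparable to [s] bounds the sum
     from below. *)
  assert (Hlow : Rpower b (- gamma) * alikhanov alpha sigma t (shifted_power alpha b t) (S k)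
                 <= d).
  { apply Hge; [|exact Hi].
    intros m; specialize (Hsol m). assert (Pb := dyadic_pos A m ltac:(lra)).
    assert (0 < Rpower (A * 2 ^ m) alpha * Rpower s (- alpha) / (s + A * 2 ^ m)).
    { apply Rdiv_lt_0_compat; [|lra]. apply Rmult_lt_0_compat; apply Rpower_pos. }
    nra. }
  specialize (Hsol i); fold b in Hsol.
  assert (Pg := Rpower_pos b (- gamma)).
  assert (F : Rpower s (- gamma - 1) <= c * d).
  (* The condition [gamma < alpha] enters here, through [s <= b]. *)
  { assert (B : Rpower s (alpha - gamma) <= Rpower b (alpha - gamma))
      by (apply Rle_Rpower_l; lra).
    assert (Psa := Rpower_pos s (- alpha)).
    assert (Pss := Rpower_pos s (alpha - gamma)).
    apply Rle_trans with ((M + 3) * (Rpower b (- gamma) *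
       (Rpower b alpha * Rpower s (- alpha) / (s + b)))).
    - replace (Rpower b (- gamma) * (Rpower b alpha * Rpower s (- alpha) / (s + b)))
        with (Rpower b (alpha - gamma) * (Rpower s (- alpha) / (s + b)))
        by (unfold Rminus; rewrite Rpower_plus; field; lra).
      replace (Rpower s (- gamma - 1)) with
        ((M + 3) * (Rpower s (alpha - gamma) * (Rpower s (- alpha) / ((M + 3) * s)))).
      + apply Rmult_le_compat_l; [lra|].
        apply Rmult_le_compat; [lra | | exact B |].
        * apply Rlt_le, Rdiv_lt_0_compat; nra.
        * apply Rmult_le_compat_l; [lra|]. apply Rinv_le_contravar; lra.
      + replace (- gamma - 1) with ((alpha - gamma) + - alpha + - (1)) by ring.
        rewrite !Rpower_plus, (Rpower_Ropp s 1), Rpower_1 by lra. field; lra.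
    - unfold c. apply Rle_trans with ((M + 3) * (Rpower b (- gamma) *
        (2 * G * alikhanov alpha sigma t (shifted_power alpha b t) (S k)))).
      + apply Rmult_le_compat_l; [lra|]. apply Rmult_le_compat_l; lra.
      + replace ((M + 3) * (Rpower b (- gamma) *
          (2 * G * alikhanov alpha sigma t (shifted_power alpha b t) (S k))))
         with (2 * G * (M + 3) * (Rpower b (- gamma) *
           alikhanov alpha sigma t (shifted_power alpha b t) (S k))) by ring.
        apply Rmult_le_compat_l; [unfold c in Hc; lra | exact Hlow]. }
  rewrite Rpower_div by lra. unfold Z.
  assert (Pt := Rpower_pos (tau t 1) (gamma + 1)).
  replace (- (gamma + 1)) with (- gamma - 1) by ring.
  apply (Rmult_le_compat_l (Rpower (tau t 1) (gamma + 1))) in F; [|lra].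
  lra.
Qed.

(** * Barriers for nonsingular right-hand sides *)

Lemma step_le_max_step (t : nat -> R) (N j : nat) :
  (1 <= j <= N)%nat -> tau t j <= max_step t N.
Proof.
intros Hj; unfold max_step.
assert (Hin : In j (seq 1 N)) by (apply in_seq; lia).
induction (seq 1 N) as [|i l IH]; [destruct Hin|].
simpl in *; destruct Hin as [-> | Hin]; [apply Rmax_l|].
eapply Rle_trans; [apply IH, Hin | apply Rmax_r].
Qed.

Lemma mesh_locate (t : nat -> R) (s : R) (m : nat) :
  t 0%nat <= s -> s < t (S m) -> exists q, (q <= m)%nat /\ t q <= s < t (S q).
Proof.
intros H0; induction m as [|m IH]; intros Hm.
- exists 0%nat; split; [lia | split; assumption].
- destruct (Rlt_dec s (t (S m))) as [Hlt | Hge].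
  + destruct (IH Hlt) as (q & Hq & H); exists q; split; [lia | exact H].
  + exists (S m); split; [lia | split; lra].
Qed.

(* [rate] makes [(rate / 2)^alpha] exceed [4 Gamma(1 - alpha) (lambda1 + lambda2)]. *)
Definition rate (alpha lambda1 lambda2 : R) : R :=
  2 * Rpower (4 * Gamma (1 - alpha) * (lambda1 + lambda2) + 1) (/ alpha).

Definition exp_power (beta mu : R) (t : nat -> R) (j : nat) : R :=
  match j with O => 0 | S _ => Rpower (t j) beta * exp (mu * t j) end.

Section Growing.

Context (alpha sigma K r T lambda1 lambda2 : R).
Context (Halpha : 0 < alpha < 1) (Hsigma : sigma = 1 - alpha / 2).
Context (Hl1 : 0 <= lambda1) (Hl2 : 0 <= lambda2).

Let G := Gamma (1 - alpha).
Let mu := rate alpha lambda1 lambda2.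

Lemma rate_pos : 0 < mu.
Proof. apply Rmult_lt_0_compat; [lra | apply Rpower_pos]. Qed.

Lemma rate_power : Rpower (mu / 2) alpha = 4 * G * (lambda1 + lambda2) + 1.
Proof.
assert (HG : 0 < G) by (apply Gamma_1_alpha_pos, Halpha).
unfold mu, rate; fold G.
replace (2 * Rpower (4 * G * (lambda1 + lambda2) + 1) (/ alpha) / 2)
  with (Rpower (4 * G * (lambda1 + lambda2) + 1) (/ alpha)) by field.
rewrite Rpower_mult, Rinv_l, Rpower_1; nra.
Qed.

Lemma rate_power_le (y : R) :
  0 < y <= 2 / mu -> Rpower (mu / 2) alpha <= Rpower y (- alpha).
Proof.
intros Hy; assert (Hmu := rate_pos).
apply Rle_trans with (Rpower (2 / mu) (- alpha)).
- right; rewrite !Rpower_div, Ropp_involutive by lra; ring.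
- apply Rpower_le_anti; lra.
Qed.

Section OneMesh.

Context (N : nat) (t : nat -> R).
Context (Hadm : admissible alpha sigma K r T (/ mu) N t).

Let Hmesh : mesh T N t := proj1 Hadm.
Let Hmono : monotone_coefs alpha sigma N t := proj1 (proj2 (proj2 Hadm)).

Lemma step_le_rate (j : nat) : (j < N)%nat -> t (S j) - t j <= / mu.
Proof.
intros Hj; rewrite <- tau_S.
eapply Rle_trans; [apply (step_le_max_step t N); lia | apply Hadm].
Qed.

(** The kernel at distance at most [/ mu] is already at least [(mu / 2)^alpha], which exceeds
    [G * lambda1]. This is one role of the threshold on the steps. *)
Lemma diagonal_dominates (k : nat) :
  (k < N)%nat -> lambda1 < coef_g alpha sigma t k k.
Proof.
intros Hk; assert (HG : 0 < G) by (apply Gamma_1_alpha_pos, Halpha).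
assert (Hmu := rate_pos).
assert (Hg := coef_g_lower alpha sigma T N t Halpha Hsigma Hmesh k k ltac:(lia)).
assert (Hx := tstar_between alpha sigma T N t Halpha Hsigma Hmesh k Hk).
assert (Hst := step_le_rate k Hk).
assert (Hp := rate_power_le (tstar sigma t (S k) - t k)).
rewrite rate_power in Hp; fold G in Hg.
assert (Him : 0 < / mu) by (apply Rinv_0_lt_compat; lra).
unfold Rdiv in Hp; specialize (Hp ltac:(lra)). nra.
Qed.

(** Both bounds instantiate [alikhanov_increasing_lower]: from [q = 0] for the first, and for the
    second from a node at distance of order [/ mu], over which the exponential at least doubles. *)
Lemma exp_power_lower (beta : R) (k : nat) :
  0 <= beta -> (k < N)%nat ->
  Rpower (t (S k)) (- alpha) * exp_power beta mu t (S k) <=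
    G * alikhanov alpha sigma t (exp_power beta mu t) (S k) /\
  Rpower (mu / 2) alpha / 2 * exp_power beta mu t (S k) <=
    G * alikhanov alpha sigma t (exp_power beta mu t) (S k) /\
  exp_power beta mu t k <= exp_power beta mu t (S k).
Proof.
intros Hbeta Hk. assert (Hmu := rate_pos).
assert (Him : 0 < / mu) by (apply Rinv_0_lt_compat; lra).
assert (Ht0 : t 0%nat = 0) by apply Hmesh.
assert (P := first_step_pos T N t Hmesh).
set (w := exp_power beta mu t).
assert (Hpos : forall j, 0 < w (S j)).
{ intros j; apply Rmult_lt_0_compat; [apply Rpower_pos | apply exp_pos]. }
assert (Hfac : forall i j, (1 <= i <= j)%nat -> (j <= N)%nat ->
   w i <= Rpower (t j) beta * exp (mu * t i)).
{ intros i j Hij HjN; destruct i as [|i]; [lia|]. unfold w; simpl.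
  apply Rmult_le_compat_r; [apply Rlt_le, exp_pos|].
  apply Rle_Rpower_l; [exact Hbeta|].
  assert (H1 := mesh_pos T N t Hmesh (S i) ltac:(lia)).
  assert (H2 := mesh_le T N t (S i) j Hmesh ltac:(lia)). lra. }
assert (Hinc : forall j, (j <= k)%nat -> w j <= w (S j)).
{ intros j Hj; destruct j as [|j]; [apply Rlt_le, Hpos|].
  eapply Rle_trans; [apply (Hfac (S j) (S (S j))); lia|].
  unfold w; simpl; apply Rmult_le_compat_l; [apply Rlt_le, Rpower_pos|].
  assert (H2 := mesh_step_pos T N t (S j) Hmesh ltac:(lia)).
  apply Rlt_le, exp_increasing. apply Rmult_lt_compat_l; lra. }
assert (L := fun q Hq => alikhanov_increasing_lower alpha sigma T N t Halpha Hsigma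
                Hmesh Hmono w k q Hq Hinc).
assert (Hx := tstar_between alpha sigma T N t Halpha Hsigma Hmesh k Hk).
assert (Htk := mesh_nonneg T N t Hmesh k ltac:(lia)).
fold G in L. assert (Pw := Hpos k).
assert (L0 : Rpower (t (S k)) (- alpha) * w (S k) <= G * alikhanov alpha sigma t w (S k)).
{ eapply Rle_trans; [|apply (L 0%nat); lia].
  rewrite Ht0, Rminus_0_r; change (w 0%nat) with 0; rewrite Rminus_0_r.
  apply Rmult_le_compat_r; [lra|]. apply Rpower_le_anti; lra. }
split; [exact L0|]; split; [|apply Hinc; lia].
assert (Pm := Rpower_pos (mu / 2) alpha).
destruct (Rle_dec (t (S k)) (2 / mu)) as [Hsmall | Hlarge].
- eapply Rle_trans; [|exact L0].
  assert (R := rate_power_le (t (S k)) ltac:(lra)). nra.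
(* At least [/ mu] separates [t q] from [t (S k)], so [w] doubles, as [2 <= exp 1]. The steps being
   at most [/ mu], the distance is also at most [2 / mu], so the kernel is at least
   [(mu / 2)^alpha]. *)
- destruct (mesh_locate t (t (S k) - / mu) k) as (q & Hq & Hq1 & Hq2);
    [unfold Rdiv in Hlarge; lra | lra |].
  eapply Rle_trans; [|apply (L q); lia].
  assert (Hst := step_le_rate q ltac:(lia)).
  assert (Hqk := mesh_le T N t q k Hmesh ltac:(lia)).
  assert (R := rate_power_le (tstar sigma t (S k) - t q)
                 ltac:(unfold Rdiv; lra)).
  assert (Hhalf : w q <= w (S k) / 2).
  { destruct q as [|q]; [change (w 0%nat) with 0; lra|].
    eapply Rle_trans; [apply (Hfac (S q) (S k)); lia|].
    change (w (S k)) with (Rpower (t (S k)) beta * exp (mu * t (S k))).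
    unfold Rdiv; rewrite Rmult_assoc.
    apply Rmult_le_compat_l; [apply Rlt_le, Rpower_pos|].
    assert (He : 2 <= exp 1).
    { apply Rlt_le; replace 2 with (1 + 1) by ring; apply exp_ineq1; lra. }
    assert (Hm : mu * t (S q) + 1 <= mu * t (S k)).
    { apply (Rmult_le_compat_l mu) in Hq1; [|lra].
      rewrite Rmult_minus_distr_l, Rinv_r in Hq1 by lra. lra. }
    assert (He2 : exp (mu * t (S q)) * exp 1 <= exp (mu * t (S k))).
    { rewrite <- exp_plus; destruct Hm as [Hm | ->]; [|lra].
      apply Rlt_le, exp_increasing, Hm. }
    assert (Pe := exp_pos (mu * t (S q))). nra. }
  replace (Rpower (mu / 2) alpha / 2 * w (S k))
    with (Rpower (mu / 2) alpha * (w (S k) / 2)) by field.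
  apply Rmult_le_compat; lra.
Qed.

End OneMesh.

Lemma growing_barrier (gamma : R) :
  gamma <= alpha - 1 ->
  has_barrier alpha sigma K r T (/ mu) lambda1 lambda2 gamma.
Proof.
intros Hg.
assert (HG : 0 < G) by (apply Gamma_1_alpha_pos, Halpha).
assert (Hmu := rate_pos).
set (beta := alpha - 1 - gamma).
exists (2 * G * exp (mu * T)); split.
{ apply Rmult_lt_0_compat; [lra | apply exp_pos]. }
intros N t Hadm. assert (Hmesh : mesh T N t) by apply Hadm.
assert (P := first_step_pos T N t Hmesh).
set (Z := 2 * G * Rpower (tau t 1) (gamma + 1)).
assert (HZ : 0 < Z) by (apply Rmult_lt_0_compat; [lra | apply Rpower_pos]).
exists (fun j => Z * exp_power beta mu t j + 0 * 0); split; [simpl; ring|].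
intros k Hk.
destruct (exp_power_lower N t Hadm beta k ltac:(unfold beta; lra) Hk) as (L1 & L2 & L3).
rewrite alikhanov_lin with (w := fun _ => 0).
assert (Hs1 := mesh_pos T N t Hmesh (S k) ltac:(lia)).
assert (HsT : t (S k) <= T).
{ rewrite <- (proj1 (proj2 (proj2 Hmesh))). apply (mesh_le T N); [exact Hmesh | lia]. }
set (s := t (S k)) in *.
assert (Hw : exp_power beta mu t (S k) = Rpower s beta * exp (mu * s)) by reflexivity.
assert (Hwpos : 0 < exp_power beta mu t (S k)).
{ rewrite Hw; apply Rmult_lt_0_compat; [apply Rpower_pos | apply exp_pos]. }
split; [split|].
- nra.
- unfold barrier; fold s.
  rewrite Rmin_right, Rpower_div by lra.
  replace (tau t 1 * Rpower s (alpha - 1) * (Rpower (tau t 1) gamma * Rpower s (- gamma)))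
    with (Rpower (tau t 1) (gamma + 1) * Rpower s beta)
    by (unfold beta, Rminus; rewrite !Rpower_plus, (Rpower_1 (tau t 1)) by lra; ring).
  rewrite Hw; unfold Z.
  assert (He : exp (mu * s) <= exp (mu * T)).
  { destruct HsT as [HsT | ->]; [|lra].
    apply Rlt_le, exp_increasing, Rmult_lt_compat_l; lra. }
  replace (2 * G * Rpower (tau t 1) (gamma + 1) * (Rpower s beta * exp (mu * s)) + 0 * 0)
    with (2 * G * Rpower (tau t 1) (gamma + 1) * Rpower s beta * exp (mu * s)) by ring.
  replace (2 * G * exp (mu * T) * (Rpower (tau t 1) (gamma + 1) * Rpower s beta))
    with (2 * G * Rpower (tau t 1) (gamma + 1) * Rpower s beta * exp (mu * T)) by ring.
  apply Rmult_le_compat_l; [|exact He].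
  apply Rlt_le, Rmult_lt_0_compat; [exact HZ | apply Rpower_pos].
- rewrite rate_power in L2.
  set (w1 := exp_power beta mu t (S k)) in *. set (w0 := exp_power beta mu t k) in *.
  set (dw := alikhanov alpha sigma t (exp_power beta mu t) (S k)) in *.
  assert (Hlow : Rpower s (- gamma - 1) <= Rpower s (- alpha) * w1).
  { rewrite Hw, <- Rmult_assoc, <- Rpower_plus.
    replace (- alpha + beta) with (- gamma - 1) by (unfold beta; ring).
    rewrite <- (Rmult_1_r (Rpower s (- gamma - 1))) at 1.
    apply Rmult_le_compat_l; [apply Rlt_le, Rpower_pos|].
    rewrite <- exp_0. apply Rlt_le, exp_increasing. apply Rmult_lt_0_compat; lra. }
  assert (Hlam : lambda2 * w0 <= lambda2 * w1) by (apply Rmult_le_compat_l; lra).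
  (* Of the two copies of [G * dw], one pays for the right-hand side through [L1], the other for
     both reaction terms through [L2]. *)
  assert (Hkey : Rpower s (- gamma - 1) <= 2 * G * (dw - lambda1 * w1 - lambda2 * w0)).
  { assert (G * (lambda2 * w0) <= G * (lambda2 * w1))
      by (apply Rmult_le_compat_l; lra).
    nra. }
  rewrite Rpower_div by lra. unfold Z.
  replace (- (gamma + 1)) with (- gamma - 1) by ring.
  apply (Rmult_le_compat_l (Rpower (tau t 1) (gamma + 1))) in Hkey;
    [|apply Rlt_le, Rpower_pos].
  lra.
Qed.

End Growing.

(** * Barriers with reaction terms *)

(** For nonnegative exponents the bound no longer depends on [gamma], while the right-hand side
    shrinks as [gamma] grows because [tau t 1 <= t (S k)]. This reaches exponents at and above
    [alpha]. *)
Lemma has_barrier_weaken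
    (alpha sigma K r T tau_max lambda1 lambda2 gamma gamma' : R) :
  0 <= gamma <= gamma' ->
  has_barrier alpha sigma K r T tau_max lambda1 lambda2 gamma ->
  has_barrier alpha sigma K r T tau_max lambda1 lambda2 gamma'.
Proof.
intros Hg (C & HC & HB); exists C; split; [exact HC|].
intros N t Hadm; destruct (HB N t Hadm) as (W & HW0 & HW).
exists W; split; [exact HW0|]; intros k Hk.
destruct (HW k Hk) as [H1 H2]. assert (Hmesh : mesh T N t) by apply Hadm.
assert (P := first_step_pos T N t Hmesh).
assert (Hs := mesh_pos T N t Hmesh (S k) ltac:(lia)).
split.
- unfold barrier in *; rewrite Rmin_left in * by lra; exact H1.
- eapply Rle_trans; [|exact H2].
  rewrite !Rpower_div, !(Rmult_comm (Rpower (tau t 1) _)) by lra.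
  rewrite <- (Ropp_involutive (gamma' + 1)) at 2.
  rewrite <- (Ropp_involutive (gamma + 1)) at 2.
  rewrite <- !Rpower_div by lra.
  replace (- (gamma' + 1)) with (- (gamma + 1) + - (gamma' - gamma)) by ring.
  rewrite (Rpower_plus (- (gamma + 1)) (- (gamma' - gamma))).
  rewrite <- (Rmult_1_r (Rpower _ (- (gamma + 1)))) at 2.
  apply Rmult_le_compat_l; [apply Rlt_le, Rpower_pos|].
  rewrite <- (Rpower_base_1 (- (gamma' - gamma))).
  apply Rpower_le_anti; [|lra]. split; [lra|].
  apply (Rmult_le_reg_r (tau t 1)); [lra|].
  unfold Rdiv; rewrite Rmult_assoc, Rinv_l by lra; lra.
Qed.

Lemma barrier_closed_form (alpha gamma : R) (t : nat -> R) (j : nat) :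
  0 < tau t 1 -> 0 < t j ->
  barrier alpha gamma t j =
  Rpower (tau t 1) (1 + Rmin 0 gamma) * Rpower (t j) (alpha - 1 - Rmin 0 gamma).
Proof.
intros P Hj; unfold barrier; rewrite Rpower_div by lra.
unfold Rminus at 2; rewrite (Rpower_plus (alpha - 1)), (Rpower_plus 1), (Rpower_1 (tau t 1)) by lra.
ring.
Qed.

(* The reaction terms of a barrier for [lambda1 = lambda2 = 0] are compensated
   by a barrier for a smaller exponent. *)
Lemma add_reaction (alpha sigma K r T tau_max lambda1 lambda2 gamma : R) :
  0 < alpha < 1 -> 1 <= r -> 0 <= lambda1 -> 0 <= lambda2 -> alpha - 1 < gamma ->
  has_barrier alpha sigma K r T tau_max 0 0 gamma ->
  has_barrier alpha sigma K r T tau_max lambda1 lambda2 (Rmin 0 gamma - alpha) ->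
  has_barrier alpha sigma K r T tau_max lambda1 lambda2 gamma.
Proof.
intros Ha Hr Hl1 Hl2 Hg (C0 & HC0 & HB0) (C1 & HC1 & HB1).
set (m := Rmin 0 gamma) in *.
assert (Hm : alpha - 1 < m <= 0).
{ split; [apply Rmin_glb_lt; lra | apply Rmin_l]. }
(* The term with [lambda2] involves the previous level, where the decreasing bound is larger; [D] is
   the loss, by the ratio of consecutive mesh points. *)
set (D := Rpower (K ^ 2 * Rpower 2 r) (- (alpha - 1 - m))).
assert (HD : 0 < D) by apply Rpower_pos.
set (c := C0 * (lambda1 + lambda2 * D)).
assert (Hc : 0 <= c).
{ apply Rmult_le_pos; [lra|]. assert (0 <= lambda2 * D) by (apply Rmult_le_pos; lra). lra. }
exists (C0 + c * C1 * Rpower T alpha); split.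
{ assert (PT := Rpower_pos T alpha).
  assert (0 <= c * C1 * Rpower T alpha); [|lra].
  apply Rmult_le_pos; [apply Rmult_le_pos|]; lra. }
intros N t Hadm.
destruct (HB0 N t Hadm) as (W0 & HW00 & HW0).
destruct (HB1 N t Hadm) as (W1 & HW10 & HW1).
assert (Hmesh : mesh T N t) by apply Hadm.
assert (Hqg : quasi_graded K r N t) by apply Hadm.
assert (P := first_step_pos T N t Hmesh).
assert (PT := Rpower_pos (tau t 1) alpha).
set (z := c * Rpower (tau t 1) alpha).
assert (Hz : 0 <= z) by (apply Rmult_le_pos; lra).
exists (fun j => 1 * W0 j + z * W1 j); split; [rewrite HW00, HW10; ring|].
intros k Hk.
destruct (HW0 k Hk) as [[A0 A1] A2]. destruct (HW1 k Hk) as [[B0 B1] B2].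
assert (Hs := mesh_pos T N t Hmesh (S k) ltac:(lia)).
set (s := t (S k)) in *.
assert (HsT : s <= T).
{ rewrite <- (proj1 (proj2 (proj2 Hmesh))). apply (mesh_le T N); [exact Hmesh | lia]. }
set (V := barrier alpha gamma t (S k)) in *.
assert (HV : V = Rpower (tau t 1) (1 + m) * Rpower s (alpha - 1 - m))
  by (apply barrier_closed_form; [|change (t (S k)) with s]; lra).
assert (HVpos : 0 < V) by (rewrite HV; apply Rmult_lt_0_compat; apply Rpower_pos).
(* This identity fixes both the exponent [m - alpha] and the weight [z]: scaled by [tau_1^alpha],
   the right-hand side of the correction is exactly [V]. *)
assert (E1 : Rpower (tau t 1) alpha * Rpower (tau t 1 / s) (m - alpha + 1) = V).
{ rewrite HV, Rpower_div, <- Rmult_assoc, <- Rpower_plus by lra.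
  f_equal; f_equal; ring. }
(* The correction is smaller than [V] by the factor [s^alpha], so bounding it by [T^alpha] preserves
   the order of the bound. *)
assert (E2 : Rpower (tau t 1) alpha * barrier alpha (m - alpha) t (S k) = V * Rpower s alpha).
{ rewrite barrier_closed_form by (change (t (S k)) with s; lra). fold s.
  rewrite (Rmin_right 0 (m - alpha)), HV, <- Rmult_assoc, <- Rpower_plus, Rmult_assoc, <- Rpower_plus by lra.
  f_equal; f_equal; ring. }
assert (Hprev : W0 k <= C0 * (D * V)).
{ destruct k as [|k].
  - rewrite HW00. apply Rmult_le_pos; [lra|]. apply Rmult_le_pos; lra.
  - destruct (HW0 k ltac:(lia)) as [[_ Hk1] _].
    assert (Hsk := mesh_pos T N t Hmesh (S k) ltac:(lia)).
    eapply Rle_trans; [exact Hk1|]. apply Rmult_le_compat_l; [lra|].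
    rewrite barrier_closed_form by lra. fold m. rewrite HV.
    replace (D * (Rpower (tau t 1) (1 + m) * Rpower s (alpha - 1 - m)))
      with (Rpower (tau t 1) (1 + m) * (Rpower s (alpha - 1 - m) * D)) by ring.
    apply Rmult_le_compat_l; [apply Rlt_le, Rpower_pos|].
    assert (HKt := ratio_const_ge_1 K r T N t Hr Hmesh Hqg).
    unfold D; rewrite <- Rpower_div by lra.
    apply Rpower_le_anti; [|lra]. split; [apply Rdiv_lt_0_compat; lra|].
    assert (Hr1 := mesh_ratio K r T N t Hr Hmesh Hqg (S k) ltac:(lia)). fold s in Hr1.
    apply (Rmult_le_reg_l (K ^ 2 * Rpower 2 r)); [lra|].
    unfold Rdiv; rewrite (Rmult_comm s), <- Rmult_assoc, Rinv_r, Rmult_1_l by lra; lra. }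
split; [split|].
- assert (0 <= z * W1 (S k)) by (apply Rmult_le_pos; lra). lra.
- assert (Hz1 : z * W1 (S k) <= z * (C1 * barrier alpha (m - alpha) t (S k)))
    by (apply Rmult_le_compat_l; lra).
  replace (z * (C1 * barrier alpha (m - alpha) t (S k)))
    with (c * C1 * (V * Rpower s alpha)) in Hz1
    by (rewrite <- E2; unfold z; ring).
  assert (HsT' : V * Rpower s alpha <= V * Rpower T alpha).
  { apply Rmult_le_compat_l; [lra | apply Rle_Rpower_l; lra]. }
  apply (Rmult_le_compat_l (c * C1)) in HsT'; [|apply Rmult_le_pos; lra].
  lra.
- rewrite alikhanov_lin.
  assert (F1 : lambda1 * W0 (S k) <= lambda1 * (C0 * V)) by (apply Rmult_le_compat_l; lra).
  assert (F2 : lambda2 * W0 k <= lambda2 * (C0 * (D * V))) by (apply Rmult_le_compat_l; lra).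
  assert (F3 : c * V <= z * (alikhanov alpha sigma t W1 (S k) - lambda1 * W1 (S k) - lambda2 * W1 k)).
  { rewrite <- E1; unfold z; rewrite <- Rmult_assoc.
    apply Rmult_le_compat_l; [exact Hz | exact B2]. }
  unfold c in F3. lra.
Qed.

(** * From barriers to stability, and induction on the exponent *)

Lemma stability_of_barrier (alpha sigma lambda1 lambda2 r T K gamma : R) :
  0 < alpha < 1 -> sigma = 1 - alpha / 2 -> 0 <= lambda1 -> 0 <= lambda2 ->
  has_barrier alpha sigma K r T (/ rate alpha lambda1 lambda2) lambda1 lambda2 gamma ->
  stability alpha sigma lambda1 lambda2 r T K (/ rate alpha lambda1 lambda2) gamma.
Proof.
intros Ha Hs Hl1 Hl2 (C & HC & HB) C0 HC0.
exists (C0 * C); split; [apply Rmult_lt_0_compat; lra|].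
intros N t Hmesh Hqg Hmono Hmax v Hv0 Hv j Hj.
assert (Hadm : admissible alpha sigma K r T (/ rate alpha lambda1 lambda2) N t)
  by exact (conj Hmesh (conj Hqg (conj Hmono Hmax))).
destruct (HB N t Hadm) as (W & HW0 & HW).
assert (Hcmp := comparison alpha sigma T N t Ha Hs Hmesh Hmono lambda1 lambda2
   (fun j => 1 * v j + - C0 * W j) Hl2
   (diagonal_dominates alpha sigma K r T lambda1 lambda2 Ha Hs Hl1 Hl2 N t Hadm)).
cbv beta in Hcmp.
assert (Hz : 1 * v j + - C0 * W j <= 0).
{ apply Hcmp; [rewrite Hv0, HW0; lra | | lia].
  intros k Hk; rewrite alikhanov_lin.
  specialize (Hv (S k) ltac:(lia)); rewrite Nat.sub_succ, Nat.sub_0_r in Hv.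
  destruct (HW k Hk) as [_ H2].
  apply (Rmult_le_compat_l C0) in H2; [|lra]. lra. }
destruct j as [|k]; [lia|].
destruct (HW k ltac:(lia)) as [[_ H1] _].
apply (Rmult_le_compat_l C0) in H1; [|lra].
rewrite <- Rmult_assoc in H1. lra.
Qed.

(** Each correction lowers the exponent by at least [alpha], so [n] counts those needed to reach
    [alpha - 1]. The corrected exponents are at most [- alpha], so they stay away from 0. *)
Lemma reaction_barrier (alpha sigma lambda1 lambda2 r T K : R) (n : nat) :
  0 < alpha < 1 -> sigma = 1 - alpha / 2 -> 0 <= lambda1 -> 0 <= lambda2 ->
  1 <= r -> r <= (3 - alpha) / alpha ->
  forall gamma, gamma <> 0 -> gamma <= alpha - 1 + INR n * alpha ->
  has_barrier alpha sigma K r T (/ rate alpha lambda1 lambda2) lambda1 lambda2 gamma.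
Proof.
intros Ha Hs Hl1 Hl2 Hr Hra; induction n as [|n IH]; intros gamma Hg0 Hg.
- simpl in Hg; apply growing_barrier; lra.
- rewrite S_INR in Hg.
  destruct (Rle_dec gamma (alpha - 1)) as [Hle | Hgt]; [apply growing_barrier; lra|].
  apply add_reaction; try lra.
  + destruct (Rlt_dec gamma alpha) as [Hlt | Hge].
    * apply singular_barrier; lra.
    (* Any exponent strictly between 0 and [alpha] would serve as well as [alpha / 2]. *)
    * apply (has_barrier_weaken _ _ _ _ _ _ _ _ (alpha / 2)); [lra|].
      apply singular_barrier; lra.
  + assert (H1 := Rmin_l 0 gamma). assert (H2 := Rmin_r 0 gamma).
    apply IH; lra.
Qed.

Theorem theorem4p1 :
  forall alpha sigma lambda1 lambda2 r T K : R,
    0 < alpha < 1 -> sigma = 1 - alpha / 2 ->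
    0 <= lambda1 -> 0 <= lambda2 -> 1 <= r -> 0 < T -> 0 < K ->
  exists tau_max : R, 0 < tau_max /\
    (r <= (3 - alpha) / alpha ->
     forall gamma : R, gamma <> 0 ->
       stability alpha sigma lambda1 lambda2 r T K tau_max gamma) /\
    (forall gamma : R, gamma <= alpha - 1 ->
       stability alpha sigma lambda1 lambda2 r T K tau_max gamma).
Proof.
intros alpha sigma lambda1 lambda2 r T K Ha Hs Hl1 Hl2 Hr HT HK.
exists (/ rate alpha lambda1 lambda2); split; [|split].
(* The threshold is determined by [alpha], [lambda1] and [lambda2]; in particular it is common to
   all [gamma] and to both parts. *)
- apply Rinv_0_lt_compat, rate_pos; assumption.
- intros Hra gamma Hg. apply stability_of_barrier; try assumption.
  destruct (INR_unbounded ((gamma - (alpha - 1)) / alpha)) as [n Hn].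
  apply (reaction_barrier _ _ _ _ _ _ _ n); try assumption.
  apply (Rmult_gt_compat_l alpha) in Hn; [|lra].
  replace (alpha * ((gamma - (alpha - 1)) / alpha)) with (gamma - (alpha - 1)) in Hn
    by (field; lra).
  lra.
- intros gamma Hg. apply stability_of_barrier; try assumption.
  apply growing_barrier; assumption.
Qed.
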